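(* Let $E=\{n_k\}_{k\ge1}\subseteq\mathbb{Z}$ be such that $|n_{k+1}/n_k|\to\infty$. Then $E$ is a (complex) metric unconditional basic sequence in every homogeneous Banach space $X$ of functions on $\mathbb{T}$. Moreover, $X_E$ has complex umap for every such $X$.
   Context: $\mathbb{T}=\{z\in\mathbb{C}:|z|=1\}$ with normalized Haar measure $m$; $e_n(z)=z^n$; $\widehat f(n)=\int fe_{-n}\,dm$. A homogeneous Banach space on $\mathbb{T}$ is a linear subspace $X$ of $L^1(\mathbb{T})$ (here containing the characters $e_n$) with a complete norm $\|\cdot\|_X\ge\|\cdot\|_1$ that is translation invariant ($\|f(\cdot\,w)\|_X=\|f\|_X$ for $w\in\mathbb{T}$) and such that $w\mapsto f(\cdot\,w)\in X$ is continuous for each $f\in X$. $X_E=\{f\in X:\widehat f(n)=0\text{ for }n\notin E\}$. $E$ is a complex metric unconditional basic sequence in $X$ if for each $\varepsilon>0$ there is a finite set $F$ such that $\|\sum_{q\in G}\epsilon_qa_qe_q\|_X\le(1+\varepsilon)\|\sum_{q\in G}a_qe_q\|_X$ for all finite $G\subseteq E\setminus F$, $a_q\in\mathbb{C}$ and $\epsilon_q\in\mathbb{T}$. A separable Banach space $Y$ has complex umap (metric unconditional approximation property) if for every $\varepsilon>0$ there is a sequence $\{T_k\}_{k\ge1}$ of bounded finite-rank operators on $Y$ with $T_ky\to y$ for all $y\in Y$ such that, with $T_0=0$, $\|\sum_{k=1}^n\epsilon_k(T_k-T_{k-1})\|\le1+\varepsilon$ for all $n$ and all $\epsilon_k\in\mathbb{T}$.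 *)

(* Defs.v *)
From HB Require Import structures.
From mathcomp Require Import all_boot all_order all_algebra generic_quotient ring_quotient.
From mathcomp Require Import complex finmap.
From mathcomp Require Import all_classical all_reals all_analysis measurable_realfun.
Set Implicit Arguments.
Unset Strict Implicit.
Unset Printing Implicit Defensive.
Import Order.TTheory GRing.Theory Num.Theory.
Import numFieldNormedType.Exports.
Local Open Scope classical_set_scope.
Local Open Scope ring_scope.
Local Open Scope complex_scope.

(* [(R[i])^o] is [R[i]] as a normed module over itself; only in that form does *)
(* it carry the usual topology.                                                *)
Definition circle (R : realType) : Type :=
  set_type [set z : (R[i])^o | `|z| = 1].

Section circle.
Variable R : realType.

HB.instance Definition _ := Topological.on (circle R).

Definition circle_val (z : circle R) : R[i] := val z.

Lemma normr_circle (z : circle R) : `|circle_val z| = 1.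
Proof. by have := set_valP z. Qed.

Definition circle_mk (z : R[i]) (z1 : `|z| = 1) : circle R :=
  exist _ (z : (R[i])^o) (mem_set z1).

Definition circle1 : circle R := circle_mk (normr1 R[i]).

Lemma circle_mul_subproof (z w : circle R) :
  `|circle_val z * circle_val w| = 1.
Proof. by rewrite normrM !normr_circle mulr1. Qed.

Definition circle_mul (z w : circle R) : circle R :=
  circle_mk (circle_mul_subproof z w).

HB.instance Definition _ := isPointed.Build (circle R) circle1.

HB.instance Definition _ := Measurable.copy (circle R)
  (g_sigma_algebraType (@open (circle R))).

Lemma cis_subproof (t : R) :
  `|cos (2 * pi * t) +i* sin (2 * pi * t)| = 1 :> R[i].
Proof. by rewrite normc_def /= cos2Dsin2 sqrtr1. Qed.

Definition cis (t : measurableTypeR R) : circle R := circle_mk (cis_subproof t).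

Lemma ltc_real_gt0 (e : R[i]) : 0 < e -> exists2 r : R, 0 < r & e = r%:C.
Proof.
by case: e => a b; rewrite ltcE /= => /andP[/eqP -> a0]; exists a.
Qed.

Lemma normc_le (a b : R) : `|a +i* b| <= (`|a| + `|b|)%:C.
Proof.
have -> : a +i* b = a%:C + 'i%C * b%:C by rewrite [LHS]complexE.
rewrite (le_trans (ler_normD _ _))// normrM !normc_def /=.
rewrite !expr0n /= !addr0 !add0r expr1n sqrtr1 mul1r !sqrtr_sqr.
by rewrite -rmorphD.
Qed.

Lemma continuous_cis : continuous (cis : R -> circle R).
Proof.
apply: continuous_comp_initial => t.
apply/cvgrPdist_lt => e /ltc_real_gt0[r r0 ->].
have c2 : (fun s : R => 2 * pi * s) @ t --> 2 * pi * t.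
  by apply: cvgM; [exact: cvg_cst|exact: cvg_id].
have cc : (fun s : R => cos (2 * pi * s)) @ t --> cos (2 * pi * t).
  by apply: (cvg_comp _ _ c2); exact: continuous_cos.
have cs : (fun s : R => sin (2 * pi * s)) @ t --> sin (2 * pi * t).
  by apply: (cvg_comp _ _ c2); exact: continuous_sin.
have r20 : 0 < r / 2 by rewrite divr_gt0.
near=> s.
rewrite /= /circle_mk set_valE /=.
apply: le_lt_trans (normc_le _ _) _; rewrite ltcR [ltRHS]splitr ltrD//.
- by near: s; move/cvgrPdist_lt : cc; exact.
- by near: s; move/cvgrPdist_lt : cs; exact.
Unshelve. all: by end_near. Qed.

Lemma measurable_cis : measurable_fun setT cis.
Proof.
apply: (measurability (@open (circle R))) => // _ [B oB <-].
rewrite setTI; apply: open_measurable.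
by apply: open_comp => // t _; exact: continuous_cis.
Qed.

HB.instance Definition _ :=
  isMeasurableFun.Build _ _ _ _ cis measurable_cis.

(* Normalized Haar measure: the law of [exp (2 i pi t)] for [t] uniform on     *)
(* the unit interval.                                                          *)
Definition haar : probability (circle R) R :=
  distribution (uniform_prob (@ltr01 R)) cis.

End circle.

Section L1.
Variable R : realType.
Notation T := (circle R).
Notation m := (haar R).
Notation Re := complex.Re.
Notation Im := complex.Im.
Implicit Types (f g : T -> R[i]).

Definition cintegrable f : Prop :=
  m.-integrable setT (EFin \o (fun z => Re (f z))) /\
  m.-integrable setT (EFin \o (fun z => Im (f z))).

Definition cintegral f : R[i] :=
  \int[m]_z Re (f z) +i* \int[m]_z Im (f z).

Definition character (n : int) (z : T) : R[i] := circle_val z ^ n.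

Lemma ReD (a b : R[i]) : Re (a + b) = Re a + Re b.
Proof. by case: a; case: b. Qed.

Lemma ImD (a b : R[i]) : Im (a + b) = Im a + Im b.
Proof. by case: a; case: b. Qed.

Lemma ReM (a b : R[i]) : Re (a * b) = Re a * Re b - Im a * Im b.
Proof. by case: a; case: b. Qed.

Lemma ImM (a b : R[i]) : Im (a * b) = Re a * Im b + Im a * Re b.
Proof. by case: a; case: b. Qed.

Lemma cintegrable0 : cintegrable (fun=> 0).
Proof. by split; exact: integrable0. Qed.

Lemma cintegrableD f g : cintegrable f -> cintegrable g ->
  cintegrable (fun z => f z + g z).
Proof.
move=> [rf jf] [rg jg]; split.
- rewrite (_ : _ \o _ = (EFin \o (fun z => Re (f z))) \+
                        (EFin \o (fun z => Re (g z))))%E; last first.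
    by apply/funext => z /=; rewrite ReD EFinD.
  exact: integrableD.
- rewrite (_ : _ \o _ = (EFin \o (fun z => Im (f z))) \+
                        (EFin \o (fun z => Im (g z))))%E; last first.
    by apply/funext => z /=; rewrite ImD EFinD.
  exact: integrableD.
Qed.

Let rZ (k : R) (u : T -> R) : m.-integrable setT (EFin \o u) ->
  m.-integrable setT (EFin \o (fun z => k * u z)).
Proof.
move=> iu; rewrite (_ : _ \o _ = (fun z => k%:E * (EFin \o u) z))%E//.
exact: integrableZl.
Qed.

Let rD (u v : T -> R) : m.-integrable setT (EFin \o u) ->
  m.-integrable setT (EFin \o v) ->
  m.-integrable setT (EFin \o (fun z => u z + v z)).
Proof.
move=> iu iv; rewrite (_ : _ \o _ = (EFin \o u) \+ (EFin \o v))%E//.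
exact: integrableD.
Qed.

Lemma cintegrableZ (a : R[i]) f : cintegrable f ->
  cintegrable (fun z => a * f z).
Proof.
move=> [rf jf]; split.
- rewrite (_ : (fun z => Re _) =
      (fun z => Re a * Re (f z) + (- Im a) * Im (f z))); last first.
    by apply/funext => z; rewrite ReM mulNr.
  by apply: rD; exact: rZ.
- rewrite (_ : (fun z => Im _) =
      (fun z => Re a * Im (f z) + Im a * Re (f z))); last first.
    by apply/funext => z; rewrite ImM.
  by apply: rD; exact: rZ.
Qed.

Definition integrable_pred : {pred T -> (R[i])^o} :=
  fun f => `[< cintegrable f >].

Lemma integrable_submod_closed : submod_closed integrable_pred.
Proof.
split; first exact/asboolP/cintegrable0.
move=> a f g /asboolP fi /asboolP gi; apply/asboolP.
exact: (cintegrableD (cintegrableZ a fi) gi).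
Qed.

HB.instance Definition _ :=
  GRing.isSubmodClosed.Build _ _ integrable_pred integrable_submod_closed.

Record L1fun := MkL1fun {
  L1fun_val :> T -> (R[i])^o;
  L1funP : L1fun_val \in integrable_pred }.

HB.instance Definition _ := [isSub for L1fun_val].
HB.instance Definition _ := [Choice of L1fun by <:].
HB.instance Definition _ := [SubChoice_isSubLmodule of L1fun by <:].

Lemma L1funZ (a : R[i]) (u : L1fun) (z : T) : (a *: u) z = a * u z.
Proof. reflexivity. Qed.

Lemma L1funB (u v : L1fun) (z : T) : (u - v) z = u z - v z.
Proof. reflexivity. Qed.

Lemma L1funD (u v : L1fun) (z : T) : (u + v) z = u z + v z.
Proof. reflexivity. Qed.

Lemma L1fun0 (z : T) : (0 : L1fun) z = 0.
Proof. reflexivity. Qed.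

Definition null_pred : {pred L1fun} :=
  fun f : L1fun => `[< (f : T -> R[i]) = (fun=> 0) %[ae m] >].

Lemma null_scale (a : R[i]) (f : L1fun) :
  f \in null_pred -> a *: f \in null_pred.
Proof.
move=> /asboolP f0; apply/asboolP; apply: filterS f0 => z /[apply] fz.
by rewrite -[LHS]/(a * f z) fz mulr0.
Qed.

Lemma null_zmod_closed : zmod_closed null_pred.
Proof.
split; first by apply/asboolP/aeW => z _; rewrite L1fun0.
move=> u v /asboolP u0 /asboolP v0; apply/asboolP.
apply: filterS2 u0 v0 => z + + tz => /(_ tz) uz /(_ tz) vz.
by rewrite L1funB uz vz subr0.
Qed.

HB.instance Definition _ :=
  GRing.isZmodClosed.Build _ null_pred null_zmod_closed.

Definition L1 : Type := Quotient.quot null_pred.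

HB.instance Definition _ := GRing.Zmodule.on L1.
HB.instance Definition _ := EqQuotient.on L1.

Local Open Scope quotient_scope.

Definition L1scale (a : R[i]) (f : L1) : L1 := \pi_L1 (a *: repr f).

Lemma pi_L1scale (a : R[i]) (f : L1fun) :
  L1scale a (\pi_L1 f) = \pi_L1 (a *: f).
Proof.
apply/eqP; rewrite /L1scale -(Quotient.idealrBE null_pred) -scalerBr.
apply: null_scale; rewrite (Quotient.idealrBE null_pred).
by rewrite reprK.
Qed.

Lemma piD (f g : L1fun) : \pi_L1 (f + g) = \pi_L1 f + \pi_L1 g.
Proof. exact: Quotient.pi_add. Qed.

Lemma L1scaleA (a b : R[i]) (f : L1) :
  L1scale a (L1scale b f) = L1scale (a * b) f.
Proof. by rewrite -[f]reprK (pi_L1scale b) !pi_L1scale scalerA. Qed.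

Lemma L1scale1 : left_id 1 L1scale.
Proof. by move=> f; rewrite -[f]reprK pi_L1scale scale1r. Qed.

Lemma L1scaleDr : right_distributive L1scale +%R.
Proof.
by move=> a f g; rewrite -[f]reprK -[g]reprK -piD !pi_L1scale -piD scalerDr.
Qed.

Lemma L1scaleDl (f : L1) : {morph L1scale^~ f : a b / a + b}.
Proof. by move=> a b; rewrite -[f]reprK !pi_L1scale -piD scalerDl. Qed.

HB.instance Definition _ := GRing.Zmodule_isLmodule.Build R[i] L1
  L1scaleA L1scale1 L1scaleDr L1scaleDl.

Definition L1rep (f : L1) : T -> R[i] := L1fun_val (repr f).
Coercion L1rep : L1 >-> Funclass.

Lemma L1rep_integrable (f : L1) : cintegrable f.
Proof. exact/asboolP/(L1funP (repr f)). Qed.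

Lemma L1_eqP (f g : L1) : (f : T -> R[i]) = g %[ae m] <-> f = g.
Proof.
split=> [fg|->]; last exact: aeW.
suff : repr f - repr g \in null_pred.
  by rewrite (Quotient.idealrBE null_pred) => /eqP; rewrite !reprK.
apply/asboolP; apply: filterS fg => z /[apply] fz.
by apply/eqP; rewrite L1funB subr_eq0; exact/eqP.
Qed.

Lemma L1rep_pi (f : L1fun) : L1rep (\pi_L1 f) = f %[ae m].
Proof.
have : repr (\pi_L1 f) - f \in null_pred.
  by rewrite (Quotient.idealrBE null_pred) reprK.
move=> /asboolP; apply: filterS => z /[apply] /eqP.
by rewrite L1funB subr_eq0 => /eqP.
Qed.

Lemma L1rep_linear (a : R[i]) (f g : L1) :
  L1rep (a *: f + g) = (fun z => a * f z + g z) %[ae m].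
Proof.
have -> : a *: f + g = \pi_L1 (a *: repr f + repr g).
  by rewrite piD -pi_L1scale !reprK.
by apply: filterS (L1rep_pi (a *: repr f + repr g)) => z /[apply] ->.
Qed.

Definition L1norm (f : L1) : R := \int[m]_z Re `|f z|.

Definition fourier (n : int) (f : L1) : R[i] :=
  cintegral (fun z => f z * character (- n) z).


Lemma continuous_circle_measurable (u : T -> R) :
  continuous u -> measurable_fun setT u.
Proof.
move=> /continuousP cu; apply: (measurability _ (RGenOpens.measurableE R)).
move=> _ [_ [a [b ->] <-]]; rewrite setTI.
by apply: sub_sigma_algebra; exact/cu/interval_open.
Qed.

Let continuous_Re : continuous (fun z : (R[i])^o => Re z).
Proof.
move=> z U /nbhs_ballP[e e0 eU].
have ec : 0 < e%:C :> R[i] by rewrite ltcR.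
apply/nbhs_ballP; exists e%:C => // w; rewrite -ball_normE /= => zw; apply: eU.
rewrite -ball_normE /= -ltcR; apply: le_lt_trans zw.
case: z w => a b [c d] /=; rewrite normc_def /= lecR.
by rewrite -sqrtr_sqr ler_wsqrtr// lerDl sqr_ge0.
Qed.

Let continuous_Im : continuous (fun z : (R[i])^o => Im z).
Proof.
move=> z U /nbhs_ballP[e e0 eU].
have ec : 0 < e%:C :> R[i] by rewrite ltcR.
apply/nbhs_ballP; exists e%:C => // w; rewrite -ball_normE /= => zw; apply: eU.
rewrite -ball_normE /= -ltcR; apply: le_lt_trans zw.
case: z w => a b [c d] /=; rewrite normc_def /= lecR.
by rewrite -sqrtr_sqr ler_wsqrtr// lerDr sqr_ge0.
Qed.

Lemma measurable_Re_val : measurable_fun setT (fun z : T => Re (circle_val z)).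
Proof.
apply: continuous_circle_measurable => z.
apply: (@continuous_comp _ (R[i])^o _ (fun z : T => circle_val z : (R[i])^o)
  (fun z => Re z)); first exact: initial_continuous.
exact: continuous_Re.
Qed.

Lemma measurable_Im_val : measurable_fun setT (fun z : T => Im (circle_val z)).
Proof.
apply: continuous_circle_measurable => z.
apply: (@continuous_comp _ (R[i])^o _ (fun z : T => circle_val z : (R[i])^o)
  (fun z => Im z)); first exact: initial_continuous.
exact: continuous_Im.
Qed.

Let cmeas f := measurable_fun setT (fun z => Re (f z)) /\
  measurable_fun setT (fun z => Im (f z)).

Let cmeasM f g : cmeas f -> cmeas g -> cmeas (fun z => f z * g z).
Proof.
move=> [rf jf] [rg jg]; split.
- rewrite (_ : (fun z => Re _) =
    (fun z => Re (f z) * Re (g z) - Im (f z) * Im (g z))); last first.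
    by apply/funext => z; rewrite ReM.
  by apply: measurable_funB; exact: measurable_funM.
- rewrite (_ : (fun z => Im _) =
    (fun z => Re (f z) * Im (g z) + Im (f z) * Re (g z))); last first.
    by apply/funext => z; rewrite ImM.
  by apply: measurable_funD; exact: measurable_funM.
Qed.

Let cmeasX f n : cmeas f -> cmeas (fun z => f z ^+ n).
Proof.
move=> mf; elim: n => [|n IHn].
  by split; [exact: (measurable_cst (1 : R))|exact: (measurable_cst (0 : R))].
rewrite (_ : (fun z => _) = (fun z => f z * f z ^+ n)); last first.
  by apply/funext => z; rewrite exprS.
exact: cmeasM.
Qed.

Let circle_inv (z : T) : (circle_val z)^-1 = (circle_val z)^*%C.
Proof.
have z1 := normr_circle z.
have z0 : circle_val z != 0.
  by apply/eqP => z0; move: z1; rewrite z0 normr0 => /eqP; rewrite eq_sym oner_eq0.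
apply: (mulfI z0); rewrite mulfV//.
have := sqr_normc (circle_val z); rewrite z1 expr1n => ->; by [].
Qed.

Let cmeas_character n : cmeas (character n).
Proof.
case: n => n; rewrite /character.
  by apply: cmeasX; split; [exact: measurable_Re_val|exact: measurable_Im_val].
rewrite (_ : (fun z => _) = (fun z : T => ((circle_val z)^*%C) ^+ n.+1)).
  apply: cmeasX; split.
    rewrite (_ : (fun z => _) = (fun z : T => Re (circle_val z))).
      exact: measurable_Re_val.
    by apply/funext => z; case: (circle_val z).
  rewrite (_ : (fun z => _) = (fun z : T => - Im (circle_val z))).
    by apply: measurableT_comp => //; exact: measurable_Im_val.
  by apply/funext => z; case: (circle_val z).
by apply/funext => z; rewrite NegzE -exprnN -exprVn circle_inv.
Qed.

Lemma normr_character n (z : T) : `|character n z| = 1.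
Proof.
rewrite /character; case: n => n.
  by rewrite -exprnP normrX normr_circle expr1n.
by rewrite NegzE -exprnN normrV ?normrX ?normr_circle ?expr1n ?invr1// unitfE
  -normr_eq0 normrX normr_circle expr1n oner_eq0.
Qed.

Lemma normr_ReIm (a : R[i]) :
  [/\ `|Re a| <= Re `|a|, `|Im a| <= Re `|a| & Re `|a| <= `|Re a| + `|Im a|].
Proof.
case: a => a b; rewrite -lecR; split.
- by rewrite normc_def /= -sqrtr_sqr ler_wsqrtr// lerDl sqr_ge0.
- by rewrite normc_def /= -sqrtr_sqr ler_wsqrtr// lerDr sqr_ge0.
- by have := normc_le a b; rewrite normc_def lecR.
Qed.

Lemma cintegrable_norm f : cintegrable f ->
  m.-integrable setT (EFin \o (fun z => Re `|f z|)).
Proof.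
move=> [rf jf].
have mr : measurable_fun setT (fun z => Re (f z)).
  by apply/measurable_EFinP; exact: (measurable_int m).
have mj : measurable_fun setT (fun z => Im (f z)).
  by apply/measurable_EFinP; exact: (measurable_int m).
apply: (@le_integrable _ _ _ m _ measurableT _
  (EFin \o (fun z => `|Re (f z)| + `|Im (f z)|))).
- apply/measurable_EFinP.
  rewrite (_ : (fun z => _) =
    Num.sqrt \o (fun z => Re (f z) ^+ 2 + Im (f z) ^+ 2)); last first.
    by apply/funext => z; rewrite normc_def.
  apply: measurableT_comp.
    by apply: continuous_measurable_fun; exact: sqrt_continuous.
  by apply: measurable_funD; apply: measurable_funX.
- move=> z _ /=; rewrite lee_fin ger0_norm; last first.
    by have [+ _ _] := normr_ReIm (f z); exact: le_trans.
  by rewrite [leRHS]ger0_norm ?addr_ge0//; have [] := normr_ReIm (f z).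
- apply: rD; exact: integrable_norm.
Qed.


Lemma cintegrable_character n f : cintegrable f ->
  cintegrable (fun z => f z * character n z).
Proof.
move=> fi; have [mr mj] : cmeas (fun z => f z * character n z).
  apply: cmeasM; last exact: cmeas_character.
  by case: fi => rf jf; split; apply/measurable_EFinP; exact: (measurable_int m).
split; apply: (@le_integrable _ _ _ m _ measurableT _ _ _ _
    (cintegrable_norm fi)); try exact/measurable_EFinP.
- move=> z _ /=; rewrite lee_fin; apply: le_trans (ler_norm _).
  have [+ _ _] := normr_ReIm (f z * character n z).
  by rewrite normrM normr_character mulr1.
- move=> z _ /=; rewrite lee_fin; apply: le_trans (ler_norm _).
  have [_ + _] := normr_ReIm (f z * character n z).
  by rewrite normrM normr_character mulr1.
Qed.

Lemma cintegralD f g : cintegrable f -> cintegrable g ->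
  cintegral (fun z => f z + g z) = cintegral f + cintegral g.
Proof.
move=> [rf jf] [rg jg]; rewrite /cintegral.
under eq_Rintegral do rewrite ReD.
under [in X in _ +i* X]eq_Rintegral do rewrite ImD.
by rewrite !RintegralD.
Qed.

Lemma cintegralZ (a : R[i]) f : cintegrable f ->
  cintegral (fun z => a * f z) = a * cintegral f.
Proof.
move=> [rf jf]; rewrite /cintegral.
under eq_Rintegral do rewrite ReM.
under [in X in _ +i* X]eq_Rintegral do rewrite ImM.
rewrite RintegralB ?RintegralD ?RintegralZl//; try exact: rZ.
by case: a.
Qed.

Lemma ae_eq_cintegral f g : cintegrable f -> cintegrable g ->
  f = g %[ae m] -> cintegral f = cintegral g.
Proof.
move=> [rf jf] [rg jg] fg; rewrite /cintegral /Rintegral.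
congr (fine _ +i* fine _); apply: ae_eq_integral => //;
  try exact: (measurable_int m).
- by apply: filterS fg => z /[apply] /= ->.
- by apply: filterS fg => z /[apply] /= ->.
Qed.

Lemma fourier_linear n (a : R[i]) (f g : L1) :
  fourier n (a *: f + g) = a * fourier n f + fourier n g.
Proof.
have fi := cintegrable_character (- n) (L1rep_integrable f).
have gi := cintegrable_character (- n) (L1rep_integrable g).
rewrite /fourier -cintegralZ// -cintegralD//; last exact: cintegrableZ.
apply: ae_eq_cintegral.
- exact/cintegrable_character/L1rep_integrable.
- exact: cintegrableD (cintegrableZ a fi) gi.
- by apply: filterS (L1rep_linear a f g) => z /[apply] ->; rewrite mulrDl mulrA.
Qed.

Lemma fourier_le n (f : L1) : `|fourier n f| <= (L1norm f + L1norm f)%:C.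
Proof.
have [ri ji] := cintegrable_character (- n) (L1rep_integrable f).
have ni := cintegrable_norm (L1rep_integrable f).
apply: le_trans (normc_le _ _) _; rewrite lecR lerD//.
- apply: le_trans (le_normr_Rintegral _ ri) _ => //.
  apply: le_Rintegral => //; first exact: integrable_norm.
  move=> z _; have [+ _ _] := normr_ReIm (f z * character (- n) z).
  by rewrite normrM normr_character mulr1.
- apply: le_trans (le_normr_Rintegral _ ji) _ => //.
  apply: le_Rintegral => //; first exact: integrable_norm.
  move=> z _; have [_ + _] := normr_ReIm (f z * character (- n) z).
  by rewrite normrM normr_character mulr1.
Qed.

End L1.

(* A linear subspace of L1 with its own complete norm is given as a Banach     *)
(* space together with an injective linear map into L1; equalities of classes  *)
(* in L1 are stated as almost everywhere equalities of representatives. Norms  *)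
(* on modules over [R[i]] take values in [R[i]], hence the casts [_%:C].       *)
Record homogeneousBanach (R : realType) := HomogeneousBanach {
  hb_space :> completeNormedModType R[i];
  hb_incl : {linear hb_space -> L1 R};
  hb_incl_inj : injective hb_incl;
  hb_character : int -> hb_space;
  hb_characterE : forall n,
    L1rep (hb_incl (hb_character n)) = @character R n %[ae haar R];
  hb_norm_ge : forall f : hb_space, (L1norm (hb_incl f))%:C <= `|f|;
  hb_translate : circle R -> hb_space -> hb_space;
  hb_translateE : forall w f,
    L1rep (hb_incl (hb_translate w f)) =
      (fun z => L1rep (hb_incl f) (circle_mul z w)) %[ae haar R];
  hb_translate_norm : forall w f, `|hb_translate w f| = `|f|;
  hb_translate_continuous : forall f, continuous (hb_translate ^~ f)
}.

Arguments hb_incl {R} X : rename.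
Arguments hb_character {R} X n : rename.
Arguments hb_translate {R} X w f : rename.

Section spectral_subspace.
Variables (R : realType) (X : homogeneousBanach R) (E : set int).

Definition spectral_pred : {pred X} :=
  fun f => `[< forall n, ~ E n -> fourier n (hb_incl X f) = 0 >].

Lemma spectral_submod_closed : submod_closed spectral_pred.
Proof.
split.
  apply/asboolP => n _; rewrite linear0.
  have := fourier_linear n (-1) (0 : L1 R) 0.
  by rewrite scaler0 addr0 mulN1r addNr.
move=> a f g /asboolP f0 /asboolP g0; apply/asboolP => n En.
by rewrite linearP fourier_linear f0// g0// mulr0 addr0.
Qed.

HB.instance Definition _ :=
  GRing.isSubmodClosed.Build _ _ spectral_pred spectral_submod_closed.

(* X_E with the norm of X; it is complete because it is closed in X *)
Record spectral := Spectral {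
  spectral_val :> X;
  spectralP : spectral_val \in spectral_pred }.

HB.instance Definition _ := [isSub for spectral_val].
HB.instance Definition _ := [Choice of spectral by <:].
HB.instance Definition _ := [SubChoice_isSubLmodule of spectral by <:].

Definition spectral_norm (f : spectral) : R[i] := `|spectral_val f|.

Lemma spectral_normD f g :
  spectral_norm (f + g) <= spectral_norm f + spectral_norm g.
Proof. exact: ler_normD. Qed.

Lemma spectral_normZ (a : R[i]) f :
  spectral_norm (a *: f) = `|a| * spectral_norm f.
Proof. exact: normrZ. Qed.

Lemma spectral_norm_eq0 f : spectral_norm f = 0 -> f = 0.
Proof. by move=> /normr0_eq0 f0; apply: val_inj. Qed.

HB.instance Definition _ := Lmodule_isNormed.Build R[i] spectral
  spectral_normD spectral_normZ spectral_norm_eq0.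

Lemma spectral_normE (f : spectral) : `|f| = `|spectral_val f|.
Proof. by []. Qed.

Lemma spectral_closed (x : X) :
  (forall e : R[i], 0 < e -> exists f : spectral, `|x - spectral_val f| < e) ->
  x \in spectral_pred.
Proof.
move=> xf; apply/asboolP => n En; apply/eqP; rewrite -normr_le0.
apply/ler_addgt0Pr => e e0; rewrite add0r.
have [f xfe] := xf _ (divr_gt0 e0 (ltr0n _ 2)).
have -> : x = 1 *: (x - spectral_val f) + spectral_val f.
  by rewrite scale1r subrK.
rewrite linearP fourier_linear.
have /asboolP -> // := spectralP f; rewrite mul1r addr0.
apply: le_trans (fourier_le _ _) _; rewrite rmorphD /= [leRHS]splitr.
by rewrite lerD//; apply: le_trans (hb_norm_ge _) (ltW _).
Qed.

Lemma spectral_complete (F : set_system spectral) :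
  ProperFilter F -> cauchy F -> cvg F.
Proof.
move=> FF /cauchyP Fc.
have GF : ProperFilter (spectral_val @ F) by exact: fmap_proper_filter.
have /cvg_ex[/= x Gx] : cvg (spectral_val @ F).
  apply: cauchy_cvg; apply/cauchy_exP => e e0; have [f Ff] := Fc e e0.
  exists (spectral_val f).
  rewrite -[_ (ball _ _)]/(F (spectral_val @^-1` ball (spectral_val f) e)).
  apply: filterS Ff => g; rewrite /preimage /= -!ball_normE; exact.
have xE : x \in spectral_pred.
  apply: spectral_closed => e e0.
  have /filter_ex[f] : F (spectral_val @^-1` ball x e) by exact/Gx/nbhsx_ballx.
  by rewrite /= -ball_normE /= => xf; exists f.
apply/cvg_ex; exists (Spectral xE) => U /nbhs_ballP[e e0 eU].
have : F (spectral_val @^-1` ball x e) by exact/Gx/nbhsx_ballx.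
by apply: filterS => f /=; rewrite -ball_normE => xf; apply: eU; rewrite -ball_normE.
Qed.

HB.instance Definition _ := Uniform_isComplete.Build spectral spectral_complete.

End spectral_subspace.

Definition metric_unconditional_basic_seq (R : realType)
    (X : homogeneousBanach R) (E : set int) : Prop :=
  forall eps : R, 0 < eps -> exists2 F : set int, finite_set F &
    forall (G : {fset int}) (a : int -> R[i]) (epsilon : int -> circle R),
      [set` G] `<=` E `\` F ->
      `|\sum_(q <- G) (circle_val (epsilon q) * a q) *: hb_character X q| <=
        (1 + eps)%:C * `|\sum_(q <- G) a q *: hb_character X q|.

Section umap.
Variables (R : realType) (Y : completeNormedModType R[i]).

Definition separable : Prop := exists2 D : set Y, countable D & dense D.

Definition opnorm_le (T : Y -> Y) (c : R) : Prop :=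
  forall y, `|T y| <= c%:C * `|y|.

Definition finite_rank (T : Y -> Y) : Prop :=
  exists (d : nat) (v : 'I_d -> Y),
    forall y, exists c : 'I_d -> R[i], T y = \sum_(i < d) c i *: v i.

Definition complex_umap : Prop :=
  separable /\
  forall eps : R, 0 < eps -> exists T : nat -> {linear Y -> Y},
    [/\ forall y, T 0%N y = 0,
        forall k, exists c, opnorm_le (T k) c,
        forall k, finite_rank (T k),
        forall y, T k y @[k --> \oo] --> y
      & forall (n : nat) (epsilon : nat -> circle R),
          opnorm_le (fun y => \sum_(1 <= k < n.+1)
            circle_val (epsilon k) *: (T k y - T k.-1 y)) (1 + eps)].

End umap.

(* Main.v *)
(** Translation by [w] is an isometry of [X] that multiplies the character
    [e_q] by [w^q].  Since the ratios [|n_(k+1) / n_k|] tend to infinity, a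
    single [w] brings [w^(n_k)] within [d] of arbitrary prescribed unimodular
    numbers for all large [k], while [w^(n_j)] stays within [d] of 1 for the
    remaining [j].  What is left after comparison with this translation is a
    multiplier of size at most [d].  As every number of the unit disc is the
    mean of two unimodular numbers, the same comparison applied to the
    remainder shows that [E] is unconditional for some constant [C], so the
    remainder costs at most [C * d].

    For the approximation property, the projections onto the first frequencies
    are controlled by such multipliers, once trigonometric polynomials with
    frequencies in [E] are known to be dense in [X_E].  Density comes from
    Fejér means.  No vector-valued integral is needed: the Riemann averages of
    [w^(-k) tau_w f] are Cauchy in [X], and their limit is an eigenvector of
    all translations, hence [hat f(k) e_k], because a function invariant under
    all rotations is constant almost everywhere. *)
Require Import Defs.
From HB Require Import structures.
From mathcomp Require Import all_boot all_order all_algebra.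
From mathcomp Require Import ring lra zify.
From mathcomp Require Import complex finmap.
From mathcomp Require Import all_classical all_reals all_analysis.
From mathcomp Require Import measurable_realfun.
Set Implicit Arguments.
Unset Strict Implicit.
Unset Printing Implicit Defensive.
Import Order.TTheory GRing.Theory Num.Theory.
Import numFieldNormedType.Exports.
Local Open Scope classical_set_scope.
Local Open Scope ring_scope.

(** * The circle and its Haar measure *)

Section cis_theory.
Variable R : realType.
Implicit Types (s t : R) (z w : circle R).
Local Notation e t := (circle_val (cis (t : R))).

Lemma circle_val_inj : injective (@circle_val R).
Proof. exact: val_inj. Qed.

Lemma circle_val_neq0 z : circle_val z != 0.
Proof. by rewrite -normr_eq0 normr_circle oner_neq0. Qed.

Lemma cisE t :
  circle_val (cis t) = (cos (2 * pi * t) +i* sin (2 * pi * t))%C.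
Proof. by []. Qed.

Lemma cis_val0 : e 0 = 1.
Proof. by rewrite cisE mulr0 cos0 sin0. Qed.

Lemma cis_valD s t : e (s + t) = e s * e t.
Proof.
rewrite !cisE mulrDr cosD sinD.
by apply/eqP; rewrite eq_complex /= eqxx /= addrC eqxx.
Qed.

Lemma cis_valN t : e (- t) = (e t)^-1.
Proof.
apply: (mulIf (circle_val_neq0 (cis t))).
by rewrite mulVf ?circle_val_neq0// -cis_valD addNr cis_val0.
Qed.

Lemma cisD s t : cis (s + t) = circle_mul (cis s) (cis t).
Proof. by apply: circle_val_inj; rewrite cis_valD. Qed.

Lemma cis0 : cis 0 = circle1 R.
Proof. by apply: circle_val_inj; rewrite cis_val0. Qed.

Lemma cis_val1 : e 1 = 1.
Proof.
rewrite cisE mulr1 mulrC mulr_natr.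
by have := cosD2pi (0 : R); have := sinD2pi (0 : R);
  rewrite add0r cos0 sin0 => -> ->.
Qed.

Lemma cis_val_natmul t k : e (k%:R * t) = e t ^+ k.
Proof.
elim: k => [|k IH]; first by rewrite mul0r cis_val0 expr0.
by rewrite -addn1 natrD mulrDl mul1r cis_valD IH exprD expr1.
Qed.

Lemma cis_val_intmul t (k : int) : e (k%:~R * t) = e t ^ k.
Proof.
case: k => k; first exact: cis_val_natmul.
by rewrite NegzE mulrNz mulNr cis_valN cis_val_natmul.
Qed.

Lemma cis_val_int (k : int) : e k%:~R = 1.
Proof. by rewrite -[k%:~R]mulr1 cis_val_intmul cis_val1 exp1rz. Qed.

Lemma cisD1 t : cis (t + 1) = cis t.
Proof. by apply: circle_val_inj; rewrite cis_valD cis_val1 mulr1. Qed.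

Lemma circle_mul1 z : circle_mul z (circle1 R) = z.
Proof. by apply: circle_val_inj; exact: mulr1. Qed.

Lemma circle_mulA : associative (@circle_mul R).
Proof. by move=> x y z; apply: circle_val_inj; exact: mulrA. Qed.

(** The angle is the arc cosine of the real part, taken with the sign of the imaginary part. *)
Lemma cis_surj z : exists t, z = cis t.
Proof.
have pi0 : 2 * pi != 0 :> R by rewrite mulf_neq0 ?gt_eqF// pi_gt0.
have := normr_circle z; case zE : (circle_val z) => [x y] xy1.
have {}xy1 : x ^+ 2 + y ^+ 2 = 1.
  move: xy1; rewrite normc_def /= => -[s1].
  have s0 : 0 <= x ^+ 2 + y ^+ 2 by rewrite addr_ge0 ?sqr_ge0.
  by rewrite -[LHS]sqr_sqrtr// s1 expr1n.
have x11 : x \in `[-1, 1].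
  rewrite in_itv /= -ler_norml -(@expr_le1 _ 2)// real_normK ?num_real// -xy1.
  by rewrite lerDl sqr_ge0.
have sx : sin (acos x) = `|y|.
  rewrite sin_acos; last by move: x11; rewrite in_itv.
  by rewrite -sqrtr_sqr; congr Num.sqrt; lra.
have [y0|y0] := leP 0 y.
  exists (acos x / (2 * pi)); apply: circle_val_inj; rewrite zE cisE.
  by rewrite [2 * pi * _]mulrC divfK// acosK// sx ger0_norm.
exists (- (acos x / (2 * pi))); apply: circle_val_inj; rewrite zE cisE.
by rewrite mulrN [2 * pi * _]mulrC divfK// cosN sinN acosK// sx ltr0_norm// opprK.
Qed.

Let lip (f df : R -> R) : (forall x : R, is_derive x (1 : R) f (df x)) ->
  (forall x, `|df x| <= 1) -> forall s t, `|f s - f t| <= `|s - t|.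
Proof.
move=> fd df1; suff H s t : s <= t -> `|f s - f t| <= `|s - t|.
  move=> s t; case: (leP s t) => [/H//|/ltW/H].
  by rewrite distrC (distrC t).
move=> st; have cf : {within `[s, t], continuous f}.
  apply: continuous_subspaceT => x.
  by apply/differentiable_continuous/derivable1_diffP; exact: ex_derive.
have [c _ E] := MVT_segment st (fun x _ => fd x) cf.
by rewrite distrC E normrM (distrC s) ler_piMl.
Qed.

Lemma cos_lip s t : `|cos s - cos t| <= `|s - t|.
Proof.
apply: lip => x; rewrite normrN ler_norml.
by apply/andP; split; [exact: sin_geN1|exact: sin_le1].
Qed.

Lemma sin_lip s t : `|sin s - sin t| <= `|s - t|.
Proof.
apply: lip => x; rewrite ler_norml.
by apply/andP; split; [exact: cos_geN1|exact: cos_le1].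
Qed.

(** Each coordinate is 2 pi-Lipschitz and a modulus is at most the sum of the absolute values of the
    coordinates, whence 4 pi. *)
Lemma cis_lip s t : `|e s - e t| <= (4 * pi * `|s - t|)%:C%C.
Proof.
rewrite !cisE; apply: le_trans (normc_le _ _) _; rewrite lecR.
have p0 : 0 <= 2 * pi :> R by rewrite mulr_ge0// pi_ge0.
have -> : 4 * pi * `|s - t| = `|2 * pi * s - 2 * pi * t| *+ 2.
  by rewrite -mulrBr normrM (ger0_norm p0) -mulr_natr; ring.
by rewrite mulr2n lerD//; [exact: cos_lip|exact: sin_lip].
Qed.

End cis_theory.

(** * Rotation invariance of Haar measure *)

Section haar_invariance.
Variable R : realType.
Local Notation m := (haar R).
Local Notation lam := (@lebesgue_measure R).

Lemma measurable_addr_const (s : R) :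
  measurable_fun setT ((fun t => t + s) : measurableTypeR R -> measurableTypeR R).
Proof. by apply: measurable_funD. Qed.

(** Half-open intervals determine Lebesgue measure, and a translation keeps their length. *)
Lemma lebesgue_measureD (s : R) (A : set (measurableTypeR R)) : measurable A ->
  lam ((fun t => t + s) @^-1` A) = lam A.
Proof.
move=> mA; rewrite -[LHS]/(pushforward lam
  ((fun t => t + s) : measurableTypeR R -> measurableTypeR R) A).
apply/esym; apply: lebesgue_measure_unique => //=.
  exact: measurable_addr_const.
move=> ms _ [[a b]] _ <-; rewrite /pushforward.
rewrite (_ : _ @^-1` _ = `]a - s, b - s]%classic); last first.
  by apply/seteqP; split => t /=; rewrite !in_itv /= ltrBlDr lerBrDr.
rewrite !lebesgue_measure_itv /= !lte_fin ltrD2r.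
by case: ifP => // _; rewrite -!EFinD; congr EFin; ring.
Qed.


Lemma haarE (A : set (circle R)) : measurable A ->
  m A = lam (@cis R @^-1` A `&` `[0, 1[%classic).
Proof.
move=> mA; have mB : measurable (@cis R @^-1` A : set (measurableTypeR R)).
  by rewrite -[X in measurable X]setTI; exact: measurable_cis.
have -> : m A = uniform_prob (@ltr01 R) (@cis R @^-1` A) by [].
rewrite /uniform_prob integral_uniform_pdf.
rewrite (eq_integral (fun=> 1%:E)); last first.
  move=> t; rewrite inE => -[_] /=.
  by rewrite in_itv /= /uniform_pdf => ->; rewrite subr0 invr1.
rewrite integral_cst ?mul1e; last exact: measurableI.
(* The uniform law lives on the closed unit interval; removing the null point 1 leaves exactly one
   period. *)
rewrite -(setUitv1 true) ?bnd_simp// setIUr measureU0//.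
- exact: measurableI.
- exact: measurableI.
- apply: (@subset_measure0 _ _ _ lam _ [set 1%R]) => //.
  - exact: measurableI.
  - exact: lebesgue_measure_set1.
Qed.

Definition circle_rot (w z : circle R) : circle R := circle_mul z w.

Lemma measurable_rot w : measurable_fun setT (circle_rot w).
Proof.
apply: (measurability (@open (circle R))) => // _ [B oB <-].
rewrite setTI; apply: sub_sigma_algebra.
apply: open_comp => // z _; apply: continuous_comp_initial.
move=> {}z; apply: (@continuous_comp _ (R[i])^o%type _
  (fun z : circle R => circle_val z : (R[i])^o) (fun x => x * circle_val w)).
  exact: initial_continuous.
exact: (@mulrr_continuous (R[i]) (circle_val w)).
Qed.

(** With [w = cis s] and 0 <= s < 1, the rotation replaces the period [0, 1[ by [s, 1 + s[;
    periodicity takes the overhang [1, 1 + s[ back to [0, s[. *)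
Lemma haar_rot w (A : set (circle R)) : measurable A -> m (circle_rot w @^-1` A) = m A.
Proof.
move=> mA; have mrA : measurable (circle_rot w @^-1` A).
  by rewrite -[X in measurable X]setTI; exact: measurable_rot.
have [t0 wt0] := cis_surj w.
pose s := t0 - (Num.floor t0)%:~R.
have /andP[fl0 fl1] := floor_itv t0.
have s0 : 0 <= s by rewrite subr_ge0.
have s1 : s < 1 by rewrite ltrBlDl -intrD1.
have {wt0} ws : w = cis s.
  rewrite wt0; apply: circle_val_inj; rewrite /s cis_valD cis_valN.
  by rewrite cis_val_int invr1 mulr1.
rewrite !haarE//; set B := @cis R @^-1` A.
have BE t : A (circle_rot w (cis t)) = A (cis (t + s)) by rewrite cisD ws.
have B1 t : A (cis (t + 1)) = A (cis t) by rewrite cisD1.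
have mB : measurable (B : set (measurableTypeR R)).
  by rewrite -[X in measurable X]setTI; exact: measurable_cis.
have -> : @cis R @^-1` (circle_rot w @^-1` A) `&` `[0, 1[%classic =
  (fun t => t + s) @^-1` (B `&` `[s, 1 + s[%classic).
  by apply/seteqP; split => t /=; rewrite !in_itv /= BE lerDr ltrD2r.
rewrite lebesgue_measureD; last exact: measurableI.
have split3 a b c : a <= b -> b <= c -> lam (B `&` `[a, c[%classic) =
   (lam (B `&` `[a, b[%classic) + lam (B `&` `[b, c[%classic))%E.
  move=> ab bc; rewrite -measureU//; try exact: measurableI.
    congr (lam _); rewrite -setIUr; congr (_ `&` _).
    apply/seteqP; split => t /=; rewrite !in_itv /=.
      by case: (ltP t b) => tb /andP[-> ->]; [left|right].
    by case=> /andP[h1 h2]; rewrite ?h1 ?h2 ?(lt_le_trans h2 bc) ?(le_trans ab h1).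
  by apply/seteqP; split => // t /= [[_ +] [_]]; rewrite !in_itv /= =>
    /andP[_ h1] /andP[h2 _]; move: (lt_le_trans h1 h2); rewrite ltxx.
rewrite (split3 s 1 (1 + s)) ?(ltW s1) ?lerDl// (split3 0 s 1) ?(ltW s1)//.
rewrite addeC; congr (_ + _)%E; rewrite -(lebesgue_measureD 1); last exact: measurableI.
congr (lam _); apply/seteqP.
by split => t /=; rewrite /B /= !in_itv /= B1 lerDr (addrC t) ltrD2l.
Qed.

End haar_invariance.

(** * Invariant integrals, and constancy of rotation-invariant functions *)

Section rotation_invariance.
Variable R : realType.
Local Notation m := (haar R).
Local Notation unif := (uniform_prob (@ltr01 R)).

Lemma ae_rot (w : circle R) (P : circle R -> Prop) :
  (\forall z \ae m, P z) -> \forall z \ae m, P (circle_rot w z).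
Proof.
move=> [A [mA A0 PA]]; exists (circle_rot w @^-1` A); split.
- by rewrite -[X in measurable X]setTI; exact: measurable_rot.
- by rewrite -A0; exact: haar_rot.
- by move=> z; exact: PA.
Qed.

Lemma ae_cis (P : circle R -> Prop) :
  (\forall z \ae m, P z) -> \forall t \ae unif, P (cis t).
Proof.
move=> [A [mA A0 PA]]; exists (@cis R @^-1` A); split.
- by rewrite -[X in measurable X]setTI; exact: measurable_cis.
- exact: A0.
- by move=> z; exact: PA.
Qed.

Lemma integral_haar_rot (w : circle R) (f : circle R -> \bar R) :
  m.-integrable setT f ->
  m.-integrable setT (f \o circle_rot w) /\
  (\int[m]_z f z = \int[m]_z (f \o circle_rot w) z)%E.
Proof.
move=> fi; have mf := measurable_int m fi.
have E (g : circle R -> \bar R) :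
    (\int[m]_z g z = \int[pushforward m (circle_rot w)]_z g z)%E.
  apply: eq_measure_integral => [|mw A mA _]; first exact: measurable_rot.
  by symmetry; exact: haar_rot.
have fri : m.-integrable setT (f \o circle_rot w).
  apply/integrableP; split; first exact: measurableT_comp (measurable_rot w).
  move/integrableP : fi => [_]; rewrite E ge0_integral_pushforward//.
    exact: measurable_rot.
  exact: measurableT_comp.
split => //; rewrite E integral_pushforward//; exact: measurable_rot.
Qed.

Lemma cintegral_rot (w : circle R) (f : circle R -> R[i]) : cintegrable f ->
  cintegrable (f \o circle_rot w) /\ cintegral (f \o circle_rot w) = cintegral f.
Proof.
move=> [rf jf].
have [rfw rE] := integral_haar_rot w rf; have [jfw jE] := integral_haar_rot w jf.
by split => //; rewrite /cintegral /Rintegral rE jE.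
Qed.

(* By Tonelli, for almost every [t] the equality [v (cis (t + s)) = v (cis t)]
   holds for almost every [s]; one such [t] gives the constant. *)
Lemma rot_invariant_ae_cst (v : circle R -> R) : measurable_fun setT v ->
  (forall w, \forall z \ae m, v (circle_rot w z) = v z) ->
  exists c, \forall z \ae m, v z = c.
Proof.
move=> mv vinv.
pose g := fun p : measurableTypeR R * measurableTypeR R =>
  (`|v (cis (p.2 + p.1)) - v (cis p.2)|)%:E.
have mcis : measurable_fun setT (@cis R) by exact: measurable_cis.
have mg : measurable_fun setT g.
  apply/measurable_EFinP; apply: measurableT_comp => //.
  apply: measurable_funB.
    do 2 apply: (measurableT_comp) => //.
    by apply: measurable_funD.
  by do 2 apply: (measurableT_comp) => //.
have g0 p : (0 <= g p)%E by rewrite lee_fin.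
have abs_g0 (h : measurableTypeR R -> \bar R) : (forall t, 0 <= h t)%E ->
    measurable_fun setT h ->
    (\int[unif]_t h t)%E = 0 <-> \forall t \ae unif, h t = 0.
  move=> h0 mh; rewrite -(@eq_integral _ _ _ unif _ h (fun t => `|h t|%E)).
    rewrite ae_eq_integral_abs//; split; first by apply: filterS => t; exact.
    by apply: filterS => t ->.
  by move=> t _; rewrite gee0_abs.
have := @fubini_tonelli _ _ _ _ _ unif unif g mg g0.
rewrite integral0_eq; last first.
  move=> s _; apply/abs_g0 => //.
    exact: (measurableT_comp mg (measurable_pair1 s)).
  apply: filterS (ae_cis (vinv (cis s))) => t /= vt.
  by rewrite /g /= cisD -/(circle_rot _ _) vt subrr normr0.
move=> /esym /abs_g0 []//.
- by move=> t; exact: integral_ge0.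
- exact: measurable_fun_fubini_tonelli_G.
have unif_gt0 : (0 < unif [set: measurableTypeR R])%E.
  by rewrite probability_setT.
(* The uniform law has positive mass, so a property that holds almost everywhere holds at some point
   [t0]. *)
move=> N N0; have [t0 ht0] : exists t, (\int[unif]_s g (s, t))%E = 0.
  have PF := ae_properfilter_algebraOfSetsType unif_gt0.
  by apply: (@filter_ex _ _ PF); exists N.
move: ht0 => /abs_g0 []//.
  exact: (measurableT_comp mg (measurable_pair2 t0)).
move=> B [mB B0 gB].
exists (v (cis t0)).
have mC : measurable [set z | v z <> v (cis t0)].
  rewrite (_ : [set _ | _] = v @^-1` (~` [set v (cis t0)])) //.
  by rewrite -[X in measurable X]setTI; apply: mv => //; exact: measurableC.
exists [set z | v z <> v (cis t0)]; split => //.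
(* Rotation by [cis t0] turns the exceptional set into the set of bad [s] for this [t0]. *)
apply: (eq_trans (esym (haar_rot (cis t0) mC))).
apply: (@subset_measure0 _ _ _ unif _ B) => //.
  rewrite -[X in measurable X]setTI; apply: mcis => //.
  by rewrite -[X in measurable X]setTI; exact: measurable_rot.
move=> s /= vs; apply: gB => /=.
rewrite /g /= => -[] /eqP; rewrite normr_eq0 subr_eq0 => /eqP vE.
by apply: vs; rewrite -vE addrC cisD.
Qed.

(** Real and imaginary parts are constant separately; the constant is the integral because the total
    mass is 1. *)
Lemma circle_rot_invariant_ae_cst (v : circle R -> R[i]) : cintegrable v ->
  (forall w, \forall z \ae m, v (circle_rot w z) = v z) ->
  \forall z \ae m, v z = cintegral v.
Proof.
move=> vi vinv; have [rv jv] := vi.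
have [c cE] : exists c : R, \forall z \ae m, complex.Re (v z) = c.
  apply: rot_invariant_ae_cst; first by apply/measurable_EFinP; exact: (measurable_int m).
  by move=> w; apply: filterS (vinv w) => z ->.
have [d dE] : exists c : R, \forall z \ae m, complex.Im (v z) = c.
  apply: rot_invariant_ae_cst; first by apply/measurable_EFinP; exact: (measurable_int m).
  by move=> w; apply: filterS (vinv w) => z ->.
have E : \forall z \ae m, v z = (c +i* d)%C.
  by apply: filterS2 cE dE => z; case: (v z) => x y /= -> ->.
apply: filterS (E) => z ->.
have k_int (k : R) : m.-integrable setT (EFin \o fun=> k).
  exact: finite_measure_integrable_cst.
rewrite (@ae_eq_cintegral _ v (fun=> (c +i* d)%C))//.
  rewrite /cintegral /= !Rintegral_cst//= probability_setT /=.
  by rewrite !mulr1.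
by apply: filterS E => y.
Qed.

End rotation_invariance.

(** * Translations and Fourier coefficients *)

Section rnorm.
Variable R : realType.
Implicit Types V : normedZmodType R[i].

(* Norms of modules over [R[i]] are complex-valued; this is their real value. *)
Definition rnorm V (x : V) : R := complex.Re `|x|.

Lemma rnormE V (x : V) : `|x| = (rnorm x)%:C%C.
Proof.
have := normr_ge0 x; rewrite /rnorm lecE /= => /andP[/eqP i0 _].
by case: `|x| i0 => a b /= ->.
Qed.

Lemma rnorm_ge0 V (x : V) : 0 <= rnorm x.
Proof. by rewrite -lecR -rnormE; exact: normr_ge0. Qed.

Lemma rnormD V (x y : V) : rnorm (x + y) <= rnorm x + rnorm y.
Proof. by rewrite -lecR rmorphD /= -!rnormE ler_normD. Qed.

Lemma rnormN V (x : V) : rnorm (- x) = rnorm x.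
Proof. by rewrite /rnorm normrN. Qed.

Lemma rnormB V (x y : V) : rnorm (x - y) = rnorm (y - x).
Proof. by rewrite /rnorm distrC. Qed.

Lemma rnorm0 V : rnorm (0 : V) = 0.
Proof. by rewrite /rnorm normr0. Qed.

Lemma rnorm_eq0 V (x : V) : rnorm x = 0 -> x = 0.
Proof. by move=> x0; apply/normr0_eq0; rewrite rnormE x0. Qed.

Lemma rnorm_sum V (I : Type) (s : seq I) (P : pred I) (F : I -> V) :
  rnorm (\sum_(i <- s | P i) F i) <= \sum_(i <- s | P i) rnorm (F i).
Proof.
elim/big_rec2: _ => [|i x y _ h]; first by rewrite rnorm0.
by apply: le_trans (rnormD _ _) _; rewrite lerD2l.
Qed.

Lemma rnorm_dist V (x y z : V) : rnorm (x - z) <= rnorm (x - y) + rnorm (y - z).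
Proof. by apply: le_trans (rnormD _ _); rewrite addrA subrK. Qed.

Lemma rnormM (a b : R[i]) : rnorm (a * b) = rnorm a * rnorm b.
Proof. by apply: complexI; rewrite rmorphM /= -!rnormE normrM. Qed.

Lemma rnormC (r : R) : rnorm (r%:C)%C = `|r|.
Proof. by rewrite /rnorm normc_def /= expr0n addr0 sqrtr_sqr. Qed.

Lemma rnorm_circle (z : circle R) : rnorm (circle_val z) = 1.
Proof. by rewrite /rnorm normr_circle. Qed.

Lemma rnormZ (V : normedModType R[i]) (a : R[i]) (x : V) :
  rnorm (a *: x) = rnorm a * rnorm x.
Proof. by apply: complexI; rewrite rmorphM /= -!rnormE normrZ. Qed.

Lemma rnorm_small V (x : V) :
  (forall e : R, 0 < e -> rnorm x <= e) -> x = 0.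
Proof.
move=> h; apply: rnorm_eq0; apply/eqP; rewrite eq_le rnorm_ge0 andbT.
by apply/ler_addgt0Pr => e e0; rewrite add0r h.
Qed.

End rnorm.

Section translations.
Variables (R : realType) (X : homogeneousBanach R).
Local Notation m := (haar R).
Local Notation tau := (hb_translate X).
Local Notation chi := (hb_character X).
Local Notation ch k := (@character R k).
Local Notation fn f := (L1rep (hb_incl X f)).
Local Notation hat k f := (fourier k (hb_incl X f)).
Local Notation ev t := (circle_val (cis (t : R))).
Implicit Types (f g u : X) (w : circle R) (k : int).

Lemma ae_app (P Q : circle R -> Prop) : (\forall z \ae m, P z) ->
  (\forall z \ae m, P z -> Q z) -> \forall z \ae m, Q z.
Proof. by move=> aP; apply: filterS2 aP => z Pz; exact. Qed.

(** Translations are specified on representatives only, so identities between them in [X] are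
    checked almost everywhere. *)
Lemma hb_ae_inj f g :
  (\forall z \ae m, fn f z = fn g z) -> f = g.
Proof.
by move=> fg; apply: (hb_incl_inj (h := X)); apply/L1_eqP; apply: filterS fg.
Qed.

Lemma tau_ae w f :
  \forall z \ae m, fn (tau w f) z = fn f (circle_rot w z).
Proof. by apply: filterS (hb_translateE (h := X) w f) => z; exact. Qed.

Lemma incl_linear_ae (a : R[i]) f g :
  \forall z \ae m, fn (a *: f + g) z = a * fn f z + fn g z.
Proof. by rewrite linearP; apply: filterS (L1rep_linear a _ _) => z; exact. Qed.

Lemma inclZ_ae (a : R[i]) f : \forall z \ae m, fn (a *: f) z = a * fn f z.
Proof.
have -> : a *: f = (a - 1) *: f + f by rewrite scalerBl scale1r subrK.
by apply: filterS (incl_linear_ae (a - 1) f f) => z ->; rewrite mulrBl mul1r subrK.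
Qed.

Lemma chi_ae k : \forall z \ae m, fn (chi k) z = ch k z.
Proof. by apply: filterS (hb_characterE X k) => z; exact. Qed.

Lemma tau_linear w (a : R[i]) f g : tau w (a *: f + g) = a *: tau w f + tau w g.
Proof.
apply: hb_ae_inj.
apply: (ae_app (tau_ae w (a *: f + g))).
apply: (ae_app (incl_linear_ae a (tau w f) (tau w g))).
apply: (ae_app (ae_rot w (incl_linear_ae a f g))).
apply: (ae_app (tau_ae w f)); apply: (ae_app (tau_ae w g)).
by apply: aeW => z h1 h2 h3 h4 h5; rewrite h5 h4 h3 h2 h1.
Qed.

Lemma tauM w w' f : tau w (tau w' f) = tau (circle_mul w w') f.
Proof.
apply: hb_ae_inj; apply: (ae_app (tau_ae w (tau w' f))).
apply: (ae_app (ae_rot w (tau_ae w' f))).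
apply: (ae_app (tau_ae (circle_mul w w') f)).
by apply: aeW => z h1 h2 h3; rewrite h3 h2 h1 /circle_rot circle_mulA.
Qed.

Lemma tau1 f : tau (circle1 R) f = f.
Proof.
by apply: hb_ae_inj; apply: filterS (tau_ae (circle1 R) f) => z ->;
  rewrite /circle_rot circle_mul1.
Qed.

Lemma tauZ w (a : R[i]) f : tau w (a *: f) = a *: tau w f.
Proof.
have t0 : tau w 0 = 0.
  by have := tau_linear w (-1) 0 0; rewrite scaler0 addr0 scaleN1r addNr.
by have := tau_linear w a f 0; rewrite t0 !addr0.
Qed.

Lemma tauD w f g : tau w (f + g) = tau w f + tau w g.
Proof. by have := tau_linear w 1 f g; rewrite !scale1r. Qed.

Lemma tau_sum w (I : Type) (s : seq I) (F : I -> X) :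
  tau w (\sum_(i <- s) F i) = \sum_(i <- s) tau w (F i).
Proof.
apply: (big_morph (tau w) (tauD w)).
by have := tauZ w 0 0; rewrite !scale0r.
Qed.

Lemma rnorm_tau w f : rnorm (tau w f) = rnorm f.
Proof. by rewrite /rnorm hb_translate_norm. Qed.

Lemma characterM k w z : ch k (circle_mul z w) = ch k z * ch k w.
Proof. by rewrite /character /= exprzMl// unitfE circle_val_neq0. Qed.

Lemma characterNK k z : ch k z * ch (- k) z = 1.
Proof. by rewrite /character -expfzDr ?circle_val_neq0// subrr expr0z. Qed.

Lemma tau_chi w k : tau w (chi k) = ch k w *: chi k.
Proof.
apply: hb_ae_inj; apply: (ae_app (tau_ae w (chi k))).
apply: (ae_app (ae_rot w (chi_ae k))); apply: (ae_app (chi_ae k)).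
apply: (ae_app (inclZ_ae (ch k w) (chi k))).
apply: aeW => z h1 h2 h3 h4; rewrite h4 h3 h1 h2.
by rewrite [LHS]characterM mulrC.
Qed.

Lemma cintegrable_fn k f : cintegrable (fun z => fn f z * ch k z).
Proof. exact/cintegrable_character/L1rep_integrable. Qed.

Lemma hat_linear k (a : R[i]) f g : hat k (a *: f + g) = a * hat k f + hat k g.
Proof. by rewrite linearP fourier_linear. Qed.

Lemma hat0 k : hat k 0 = 0.
Proof. by rewrite -[X in hat k X](addNr 0) -scaleN1r hat_linear mulN1r addNr. Qed.

Lemma hatZ k (a : R[i]) f : hat k (a *: f) = a * hat k f.
Proof. by rewrite -[X in hat k X]addr0 hat_linear hat0 addr0. Qed.

Lemma hatD k f g : hat k (f + g) = hat k f + hat k g.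
Proof. by rewrite -[X in hat k (X + _)]scale1r hat_linear mul1r. Qed.

Lemma hat_sum k (I : Type) (s : seq I) (F : I -> X) :
  hat k (\sum_(i <- s) F i) = \sum_(i <- s) hat k (F i).
Proof.
by apply: (big_morph (fun f => hat k f) (hatD k)); exact: hat0.
Qed.

(** The factor 2 comes from bounding real and imaginary parts separately. *)
Lemma hat_le k f : rnorm (hat k f) <= 2 * rnorm f.
Proof.
rewrite -lecR -rnormE; apply: le_trans (fourier_le _ _) _.
have h := hb_norm_ge (h := X) f; rewrite rnormE lecR in h.
by rewrite lecR mulr_natl mulr2n lerD.
Qed.

Lemma hat_tau k w f : hat k (tau w f) = ch k w * hat k f.
Proof.
have [ri E] := cintegral_rot w (cintegrable_fn (- k) f).
rewrite -[hat k f]/(cintegral (fun z => fn f z * ch (- k) z)) -E -(cintegralZ _ ri).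
apply: ae_eq_cintegral; [exact: cintegrable_fn|exact: cintegrableZ|].
apply: filterS (tau_ae w f) => z h _; rewrite h /=.
rewrite [ch (- k) (circle_rot w z)]characterM mulrCA.
by rewrite [ch k w * _]mulrCA characterNK mulr1.
Qed.

Lemma hat_chi_eq k : hat k (chi k) = 1.
Proof.
rewrite /fourier (@ae_eq_cintegral _ _ (fun=> 1)).
- rewrite /cintegral /= !Rintegral_cst//= probability_setT /=.
  by rewrite !mulr1.
- exact: cintegrable_fn.
- by split; exact: finite_measure_integrable_cst.
- by apply: filterS (chi_ae k) => z -> _; exact: characterNK.
Qed.

(** For [k != l], a rotation [w] with w^(l - k) = -1 makes the coefficient equal to its own
    negative. *)
Lemma hat_chi k l : hat k (chi l) = (k == l)%:R.
Proof.
have [->|kl] := eqVneq k l; first exact: hat_chi_eq.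
pose w := cis (((l - k)%:~R * 2)^-1 : R).
have E : hat k (tau w (chi l)) = ch l w * hat k (chi l).
  by rewrite tau_chi hatZ.
rewrite hat_tau in E.
have {}E : hat k (chi l) = ch (l - k) w * hat k (chi l).
  have -> : ch (l - k) w = ch l w * ch (- k) w.
    by rewrite /character expfzDr// circle_val_neq0.
  by rewrite mulrAC -E mulrAC characterNK mul1r.
have w1 : ch (l - k) w = -1.
  rewrite /character -cis_val_intmul invfM mulrA mulfV ?mul1r; last first.
    by rewrite intr_eq0 subr_eq0 eq_sym.
  by rewrite cisE mulrAC mulfV// mul1r cospi sinpi; simpc.
rewrite w1 mulN1r in E; have /eqP : hat k (chi l) *+ 2 = 0.
  by rewrite mulr2n {1}E addNr.
by rewrite mulrn_eq0 => /eqP.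
Qed.

(* [z^(-k) u(z)] is invariant under rotations, hence constant. *)
Lemma eigen_chi k u : (forall w, tau w u = ch k w *: u) ->
  u = hat k u *: chi k.
Proof.
move=> uE; have ui := cintegrable_fn (- k) u.
have cst := circle_rot_invariant_ae_cst ui.
apply: hb_ae_inj; apply: (ae_app (inclZ_ae (hat k u) (chi k))).
apply: (ae_app (chi_ae k)); apply: (ae_app (cst _)) => [w|].
  apply: (ae_app (tau_ae w u)); rewrite uE.
  apply: (ae_app (inclZ_ae (ch k w) u)).
  apply: aeW => z -> <-; rewrite [ch _ (circle_rot w z)]characterM.
  by rewrite [ch (- k) z * _]mulrC mulrACA characterNK mul1r.
apply: aeW => z h1 h2 ->; rewrite h2 /fourier -h1 -mulrA.
by rewrite [ch (- k) z * _]mulrC characterNK mulr1.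
Qed.

End translations.

(** * Fejér means in a homogeneous Banach space *)

Section averages.
Variables (R : realType) (X : homogeneousBanach R).
Local Notation tau := (hb_translate X).
Local Notation chi := (hb_character X).
Local Notation hat k f := (fourier k (hb_incl X f)).
Local Notation ev t := (circle_val (cis (t : R))).
Local Notation ch k := (@character R k).
Implicit Types (f g u : X) (w : circle R) (k : int) (s t : R).

Lemma tau_continuous1 f (eta : R) : 0 < eta ->
  exists2 d : R, 0 < d & forall w, rnorm (circle_val w - 1) < d ->
    rnorm (tau w f - f) <= eta.
Proof.
move=> eta0; have e0 : 0 < (eta%:C)%C :> R[i] by rewrite ltcR.
have := @hb_translate_continuous R X f (circle1 R).
move=> /cvgrPdist_lt /(_ _ e0) [U [oU U1] UE].
(* The topology of the circle is induced from the complex plane, so a neighbourhood of 1 contains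
   the trace of a disc. *)
case: oU => B oB BU; move: U1; rewrite -BU => B1.
have /nbhs_ballP[r /ltc_real_gt0[d d0 ->] dB] : nbhs (1 : (R[i])^o) B.
  by apply: open_nbhs_nbhs; split.
exists d => // w wd.
have : U w.
  rewrite -BU /=; apply: dB; rewrite -ball_normE /= distrC rnormE ltcR.
  exact: wd.
by move=> /UE /=; rewrite tau1 rnormE ltcR rnormB => /ltW.
Qed.

(* [w^(-k) tau_w] for [w = cis t]: a one-parameter group of isometries fixing
   the Fourier coefficient of index [k]. *)
Definition mtau k t f : X := ev (- (k%:~R * t)) *: tau (cis t) f.

Lemma mtauD k s t f : mtau k (s + t) f = mtau k s (mtau k t f).
Proof.
rewrite /mtau tauZ scalerA tauM -cisD; congr (_ *: _).
by rewrite -cis_valD; congr (ev _); ring.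
Qed.

Lemma mtau0 k f : mtau k 0 f = f.
Proof. by rewrite /mtau mulr0 oppr0 cis_val0 cis0 tau1 scale1r. Qed.

Lemma mtau1 k f : mtau k 1 f = f.
Proof.
rewrite /mtau mulr1 -mulrNz cis_val_int scale1r.
by rewrite (_ : cis 1 = circle1 R) ?tau1//; rewrite -(addr0 1) addrC cisD1 cis0.
Qed.

Lemma mtauZ k t (a : R[i]) f : mtau k t (a *: f) = a *: mtau k t f.
Proof. by rewrite /mtau tauZ !scalerA mulrC. Qed.

Lemma mtauDr k t f g : mtau k t (f + g) = mtau k t f + mtau k t g.
Proof. by rewrite /mtau tauD scalerDr. Qed.

Lemma mtauB k t f g : mtau k t (f - g) = mtau k t f - mtau k t g.
Proof. by rewrite -scaleN1r mtauDr mtauZ scaleN1r. Qed.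

Lemma mtau_sum k t (I : Type) (r : seq I) (F : I -> X) :
  mtau k t (\sum_(i <- r) F i) = \sum_(i <- r) mtau k t (F i).
Proof. by rewrite /mtau tau_sum scaler_sumr. Qed.

Lemma rnorm_mtau k t f : rnorm (mtau k t f) = rnorm f.
Proof. by rewrite rnormZ rnorm_circle mul1r rnorm_tau. Qed.

Lemma hat_mtau k t f : hat k (mtau k t f) = hat k f.
Proof.
by rewrite hatZ hat_tau mulrA /character -cis_val_intmul -cis_valD addNr
  cis_val0 mul1r.
Qed.

Lemma mtau_small k f (eta : R) : 0 < eta ->
  exists2 d : R, 0 < d & forall t, 0 <= t <= d -> rnorm (mtau k t f - f) <= eta.
Proof.
move=> eta0; have eta20 : 0 < eta / 2 by rewrite divr_gt0.
have [d d0 dE] := tau_continuous1 f eta20.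
pose C : R := 4 * pi.
have C0 : 0 < C by rewrite mulr_gt0// pi_gt0.
have evl t : rnorm (ev t - 1) <= C * `|t|.
  have := @cis_lip R t 0; rewrite cis_val0 subr0.
  by rewrite rnormE lecR.
pose K : R := `|k%:~R| * rnorm f.
have K0 : 0 <= K by rewrite mulr_ge0// rnorm_ge0.
have K10 : 0 < K + 1 by rewrite ltr_wpDl.
(* The first bound makes [dE] applicable, the second keeps the scalar factor within eta / 2; [K + 1]
   avoids a zero denominator. *)
exists (Num.min (d / (2 * C)) (eta / 2 / (C * (K + 1)))).
  by rewrite lt_min !divr_gt0// mulr_gt0.
move=> t /andP[t0]; rewrite le_min => /andP[td tk].
have -> : mtau k t f - f = ev (- (k%:~R * t)) *: (tau (cis t) f - f)
    + (ev (- (k%:~R * t)) - 1) *: f.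
  by rewrite scalerBr scalerBl scale1r addrA subrK.
apply: le_trans (rnormD _ _) _; rewrite !rnormZ rnorm_circle mul1r.
rewrite [leRHS]splitr lerD//.
  apply: dE; apply: le_lt_trans (evl t) _; rewrite ger0_norm//.
  apply: le_lt_trans (_ : C * (d / (2 * C)) < _); first by rewrite ler_pM2l.
  rewrite (_ : C * _ = d / 2); last by field; rewrite gt_eqF.
  by lra.
apply: le_trans (_ : C * (K * t) <= _).
  have -> : C * (K * t) = C * (`|k%:~R| * t) * rnorm f by rewrite /K; ring.
  apply: ler_wpM2r; first exact: rnorm_ge0.
  by apply: le_trans (evl _) _; rewrite normrN normrM (ger0_norm t0).
apply: le_trans (_ : C * (K + 1) * t <= _).
  by rewrite mulrA; apply: ler_wpM2r => //; rewrite ler_pM2l// lerDl.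
by rewrite mulrC -ler_pdivlMr// mulr_gt0.
Qed.

(** Riemann sum over the N-th roots of unity for the vector-valued integral of w^(-k) tau_w f. *)
Definition avg k (N : nat) f : X :=
  (N%:R^-1 : R[i]) *: \sum_(0 <= j < N) mtau k (j%:R / N%:R) f.

Lemma avgB k N f g : avg k N (f - g) = avg k N f - avg k N g.
Proof.
rewrite /avg -scalerBr -sumrB; congr (_ *: _).
by apply: eq_bigr => j _; rewrite mtauB.
Qed.

Lemma rnorm_natV (N : nat) : rnorm (N%:R^-1 : R[i]) = N%:R^-1.
Proof.
rewrite (_ : N%:R^-1 = (N%:R^-1)%:C%C); last by rewrite fmorphV /= rmorph_nat.
by rewrite rnormC ger0_norm.
Qed.

Lemma mean_le (N : nat) (F : nat -> X) (c : R) : (0 < N)%N ->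
  (forall j, (j < N)%N -> rnorm (F j) <= c) ->
  rnorm ((N%:R^-1 : R[i]) *: \sum_(0 <= j < N) F j) <= c.
Proof.
move=> N0 Fc; rewrite rnormZ rnorm_natV ler_pdivrMl ?ltr0n//.
apply: le_trans (rnorm_sum _ _ _) _.
rewrite mulr_natl -[N in leRHS]subn0 -sumr_const_nat.
by apply: ler_sum_nat => j /andP[_]; exact: Fc.
Qed.

Lemma rnorm_avg k N f : (0 < N)%N -> rnorm (avg k N f) <= rnorm f.
Proof. by move=> N0; apply: mean_le => // j _; rewrite rnorm_mtau. Qed.

Lemma hat_avg k N f : (0 < N)%N -> hat k (avg k N f) = hat k f.
Proof.
move=> N0; rewrite hatZ hat_sum (eq_bigr (fun=> hat k f)) => [|j _].
  rewrite sumr_const_nat subn0 -[hat k f *+ N]mulr_natl mulrA mulVf ?mul1r//.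
  by rewrite pnatr_eq0 -lt0n.
exact: hat_mtau.
Qed.

(** The shift by 1 / N permutes the nodes cyclically: the one that reaches 1 returns to 0, as [mtau]
    has period 1. *)
Lemma mtau_avg k N f : (0 < N)%N -> mtau k N%:R^-1 (avg k N f) = avg k N f.
Proof.
move=> N0; rewrite /avg mtauZ mtau_sum; congr (_ *: _).
rewrite (eq_bigr (fun j => mtau k (j.+1%:R / N%:R) f)); last first.
  by move=> j _; rewrite -mtauD -[j.+1]add1n natrD mulrDl mul1r.
case: N N0 => // N _; rewrite big_nat_recr//= [RHS]big_nat_recl//= addrC.
by rewrite mulfV ?pnatr_eq0// mul0r mtau0 mtau1.
Qed.

(** The nodes of the finer average are j / N + i / (N M) with i < M. *)
Lemma avgM k N M f : (0 < N)%N -> (0 < M)%N -> avg k (N * M) f =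
  avg k N ((M%:R^-1 : R[i]) *: \sum_(0 <= i < M) mtau k (i%:R / (N * M)%:R) f).
Proof.
move=> N0 M0; rewrite /avg; under [in RHS]eq_bigr do rewrite mtauZ mtau_sum.
rewrite -scaler_sumr scalerA -invfM -natrM mulnC; congr (_ *: _).
rewrite mulnC big_nat_mul /=; apply: eq_bigr => j _.
rewrite -[X in \sum_(X <= _ < _) _]add0n mulSn big_addn addnK.
apply: eq_big_nat => i _; rewrite -mtauD; congr mtau.
rewrite natrD !natrM mulrDl addrC; congr (_ + _); field.
by rewrite !pnatr_eq0 -!lt0n N0.
Qed.

(** The inner average only involves times below 1 / N, so it stays near [f]; the outer average does
    not increase norms. *)
Lemma avg_dist k f (eta : R) : 0 < eta -> exists N0, forall N M,
  (N0 <= N)%N -> (0 < N)%N -> (0 < M)%N ->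
  rnorm (avg k (N * M) f - avg k N f) <= eta.
Proof.
move=> /(mtau_small k f)[d d0 dE].
exists (Num.truncn d^-1).+1 => N M N0N Np Mp.
have Nd : N%:R^-1 <= d.
  rewrite invf_ple ?posrE ?ltr0n//; apply: ltW.
  by apply: lt_le_trans (truncnS_gt _) _; rewrite ler_nat.
rewrite avgM// -avgB; apply: le_trans (rnorm_avg _ _ Np) _.
have -> : (M%:R^-1 : R[i]) *: (\sum_(0 <= i < M) mtau k (i%:R / (N * M)%:R) f) - f
    = (M%:R^-1 : R[i]) *: \sum_(0 <= i < M) (mtau k (i%:R / (N * M)%:R) f - f).
  rewrite sumrB sumr_const_nat subn0 -[f *+ M]scaler_nat scalerBr scalerA.
  by rewrite mulVf ?scale1r// pnatr_eq0 -lt0n.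
apply: mean_le => // i iM; apply: dE; rewrite divr_ge0//=.
apply: le_trans Nd; rewrite natrM invfM mulrCA ler_piMr ?invr_ge0//.
by rewrite ler_pdivrMr ?ltr0n// mul1r ler_nat ltnW.
Qed.

(** Two averages are compared through their common refinement with [N * M] nodes. *)
Lemma avg_cauchy k f (eta : R) : 0 < eta -> exists N0, forall N M,
  (N0 <= N)%N -> (N0 <= M)%N -> (0 < N)%N -> (0 < M)%N ->
  rnorm (avg k N f - avg k M f) <= eta.
Proof.
move=> eta0; have [N0 h] := avg_dist k f (divr_gt0 eta0 (ltr0n R 2)).
exists N0 => N M N0N N0M Np Mp.
apply: le_trans (rnorm_dist _ (avg k (N * M) f) _) _.
rewrite [leRHS]splitr; apply: lerD; first by rewrite rnormB; exact: h.
by rewrite mulnC; exact: h.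
Qed.

Lemma avg_limit k f : exists u, forall eta : R, 0 < eta -> exists N0, forall N,
  (N0 <= N)%N -> (0 < N)%N -> rnorm (avg k N f - u) <= eta.
Proof.
have : cauchy (avg k N.+1 f @[N --> \oo]).
  apply/cauchy_exP => e /ltc_real_gt0[r r0 ->].
  have [N0 h] := avg_cauchy k f (divr_gt0 r0 (ltr0n R 2)).
  exists (avg k N0.+1 f); exists N0 => // N /= N0N.
  rewrite -ball_normE /= rnormE ltcR; apply: le_lt_trans (h _ _ _ _ _ _) _ => //.
  - exact: leqW.
  - by rewrite ltr_pdivrMr// ltr_pMr// ltr1n.
move=> /cauchy_cvg /cvg_ex[/= u /cvgrPdist_lt uE]; exists u => eta eta0.
have /uE[N0 _ h] : 0 < (eta%:C)%C :> R[i] by rewrite ltcR.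
exists N0.+1 => -[//|N] N0N _.
by have /= := h N N0N; rewrite rnormE ltcR rnormB => /ltW.
Qed.

(** Averages whose number of nodes is a multiple of N are fixed by the shift 1 / N, hence so is the
    limit, and then by every j / N; continuity at 0 gives the other times. *)
Lemma mtau_limit k f u : (forall eta : R, 0 < eta -> exists N0, forall N,
    (N0 <= N)%N -> (0 < N)%N -> rnorm (avg k N f - u) <= eta) ->
  forall t, 0 <= t -> mtau k t u = u.
Proof.
move=> uE; have step (N : nat) : (0 < N)%N -> mtau k N%:R^-1 u = u.
  move=> Np; apply/eqP; rewrite -subr_eq0; apply/eqP/rnorm_small => e e0.
  have [N0 h] := uE _ (divr_gt0 e0 (ltr0n R 2)).
  have Mp : (0 < N * N0.+1)%N by rewrite muln_gt0 Np.
  have {}h := h _ (leq_trans (leqnSn N0) (leq_pmull _ Np)) Mp.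
  have E : mtau k N%:R^-1 (avg k (N * N0.+1) f) = avg k (N * N0.+1) f.
    by rewrite avgM// mtau_avg.
  apply: le_trans (rnorm_dist _ (avg k (N * N0.+1) f) _) _.
  by rewrite [leRHS]splitr lerD// -{1}E -mtauB rnorm_mtau rnormB.
have stepj (N j : nat) : (0 < N)%N -> mtau k (j%:R / N%:R) u = u.
  move=> Np; elim: j => [|j IH]; first by rewrite mul0r mtau0.
  by rewrite -addn1 natrD mulrDl mul1r mtauD step.
move=> t t0; apply/eqP; rewrite -subr_eq0; apply/eqP/rnorm_small => e e0.
have [d d0 dE] := mtau_small k u e0.
pose N := (Num.truncn d^-1).+1.
have Nd : N%:R^-1 <= d.
  by rewrite invf_ple ?posrE ?ltr0n//; apply: ltW; exact: truncnS_gt.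
have N0 : 0 < N%:R :> R by rewrite ltr0n.
pose j := Num.truncn (t * N%:R).
have /andP[j1 j2] : j%:R <= t * N%:R < j.+1%:R by apply: truncn_itv; rewrite mulr_ge0.
have -> : t = (t - j%:R / N%:R) + j%:R / N%:R by rewrite subrK.
rewrite mtauD stepj//; apply: dE; rewrite subr_ge0 ler_pdivrMr// j1 /=.
apply: le_trans Nd; rewrite lerBlDl -[X in _ + X]mul1r -mulrDl ler_pdivlMr// natr1.
exact: ltW.
Qed.

Lemma avg_cvg k f (eta : R) : 0 < eta -> exists N0, forall N,
  (N0 <= N)%N -> (0 < N)%N -> rnorm (avg k N f - hat k f *: chi k) <= eta.
Proof.
move=> eta0; have [u uE] := avg_limit k f.
suff <- : u = hat k f *: chi k by exact: uE.
(* Averaging keeps the coefficient of index [k], and [hat_le] makes this coefficient continuous. *)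
have <- : hat k u = hat k f.
  apply/eqP; rewrite eq_sym -subr_eq0; apply/eqP/rnorm_small => e e0.
  have [N0 h] := uE _ (divr_gt0 e0 (ltr0n R 2)).
  have {}h := h _ (leqnSn N0) isT.
  have -> : hat k f - hat k u = hat k (avg k N0.+1 f - u).
    have := hat_linear k (-1) u (avg k N0.+1 f).
    by rewrite scaleN1r mulN1r hat_avg// addrC => ->; rewrite addrC.
  by apply: le_trans (hat_le _ _) _; rewrite mulrC -ler_pdivlMr.
apply: eigen_chi => w; have [t0 wt0] := cis_surj w.
(* The angle is reduced modulo 1 because [mtau_limit] covers nonnegative times only. *)
pose t := t0 - (Num.floor t0)%:~R.
have {wt0} wt : w = cis t.
  rewrite wt0; apply: circle_val_inj.
  by rewrite /t cis_valD cis_valN cis_val_int invr1 mulr1.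
have t_ge0 : 0 <= t by rewrite subr_ge0; have /andP[] := floor_itv t0.
have := mtau_limit uE t_ge0; rewrite /mtau -wt => {2}<-.
rewrite scalerA /character wt -cis_val_intmul -cis_valD subrr cis_val0.
by rewrite scale1r.
Qed.

End averages.

(** * Fejér kernel and density of trigonometric polynomials *)

Section fejer.
Variables (R : realType) (X : homogeneousBanach R).
Local Notation tau := (hb_translate X).
Local Notation chi := (hb_character X).
Local Notation hat k f := (fourier k (hb_incl X f)).
Local Notation ev t := (circle_val (cis (t : R))).
Local Notation ch k := (@character R k).
Implicit Types (f g u : X) (w : circle R) (k : int) (s t : R) (n : nat).

Definition dirichlet n w : R[i] := \sum_(0 <= a < n) circle_val w ^+ a.

(** The Fejér kernel, written as a square so that its positivity is immediate. *)
Definition fejer n w : R := rnorm (dirichlet n w) ^+ 2 / n%:R.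

Lemma fejer_ge0 n w : 0 <= fejer n w.
Proof. by rewrite divr_ge0// sqr_ge0. Qed.

(** The product of w - 1 with the geometric sum is w^n - 1, of modulus at most 2. *)
Lemma fejer_le n w (d : R) : (0 < n)%N -> 0 < d -> d <= rnorm (circle_val w - 1) ->
  fejer n w <= 4 / (n%:R * d ^+ 2).
Proof.
move=> n0 d0 dw; have w0 := lt_le_trans d0 dw.
have D2 : d * rnorm (dirichlet n w) <= 2.
  apply: le_trans (_ : rnorm (circle_val w - 1) * rnorm (dirichlet n w) <= _).
    by apply: ler_wpM2r => //; exact: rnorm_ge0.
  rewrite -rnormM /dirichlet big_mkord -subrX1; apply: le_trans (rnormD _ _) _.
  rewrite rnormN [rnorm 1]/rnorm normr1 /rnorm normrX normr_circle expr1n /=.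
  by rewrite -natr1.
have n0R : 0 < n%:R :> R by rewrite ltr0n.
rewrite ler_pdivlMr ?mulr_gt0 ?exprn_gt0//.
have -> : fejer n w * (n%:R * d ^+ 2) = (d * rnorm (dirichlet n w)) ^+ 2.
  by rewrite /fejer exprMn; field; rewrite gt_eqF.
have -> : 4 = 2 ^+ 2 :> R by rewrite expr2; lra.
by rewrite ler_sqr ?nnegrE// mulr_ge0 ?rnorm_ge0// ltW.
Qed.

(** A frequency k with |k| < n is listed n - |k| times, which is n times its Fejér weight. *)
Definition fejer_freqs n : seq int :=
  [seq a%:Z - b%:Z | a <- index_iota 0 n, b <- index_iota 0 n].

(** Expansion of the squared modulus; the minus sign in the exponents matches the scalar factor of
    [mtau]. *)
Lemma fejerE n t : (fejer n (cis t))%:C%C =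
  n%:R^-1 * \sum_(k <- fejer_freqs n) ev (- (k%:~R * t)).
Proof.
rewrite /fejer rmorphM /= fmorphV /= rmorph_nat mulrC; congr (_ * _).
rewrite rmorphXn /= -rnormE sqr_normc.
have conjE (z : circle R) : (circle_val z)^*%C = (circle_val z)^-1.
  apply: (mulfI (circle_val_neq0 z)); rewrite -sqr_normc normr_circle.
  by rewrite mulfV ?circle_val_neq0// expr1n.
under [RHS]eq_bigr do rewrite -mulNr -rmorphN cis_val_intmul.
move: (cis t) => z; have z0 := circle_val_neq0 z.
rewrite big_allpairs_dep /= /dirichlet mulrC rmorph_sum /= mulr_suml.
apply: eq_bigr => a _; rewrite mulr_sumr; apply: eq_bigr => b _.
by rewrite rmorphXn /= conjE opprB expfzDr// -invr_expz exprVn mulrC.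
Qed.

(** Riemann sum for the convolution of [f] with the Fejér kernel; for fixed [n] it tends to
    [fejer_sum n f]. *)
Definition fejer_mean n N f : X :=
  (N%:R^-1 : R[i]) *: \sum_(0 <= j < N)
    (fejer n (cis (j%:R / N%:R)))%:C%C *: tau (cis (j%:R / N%:R)) f.

Lemma fejer_meanE n N f : fejer_mean n N f =
  (n%:R^-1 : R[i]) *: \sum_(k <- fejer_freqs n) avg k N f.
Proof.
rewrite /avg -scaler_sumr scalerA [_ * N%:R^-1]mulrC -scalerA; congr (_ *: _).
rewrite exchange_big /= scaler_sumr; apply: eq_bigr => j _.
by rewrite fejerE -scalerA scaler_suml.
Qed.

Definition fejer_sum n f : X :=
  (n%:R^-1 : R[i]) *: \sum_(k <- fejer_freqs n) hat k f *: chi k.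

Lemma avg_cvg_seq (r : seq int) f (eta : R) : 0 < eta -> exists N0, forall N,
  (N0 <= N)%N -> (0 < N)%N -> {in r, forall k, rnorm (avg k N f - hat k f *: chi k) <= eta}.
Proof.
move=> eta0; elim: r => [|k r [N0 IH]]; first by exists 0%N.
have [N1 h] := avg_cvg k f eta0; exists (maxn N0 N1) => N.
rewrite geq_max => /andP[N0N N1N] Np l; rewrite inE => /orP[/eqP ->|lr].
  exact: h.
exact: IH.
Qed.

Lemma fejer_mean_cvg n f (eta : R) : (0 < n)%N -> 0 < eta -> exists N0, forall N,
  (N0 <= N)%N -> (0 < N)%N -> rnorm (fejer_mean n N f - fejer_sum n f) <= eta.
Proof.
move=> n0 eta0; have n0R : 0 < n%:R :> R by rewrite ltr0n.
(* The list has n^2 entries and the prefactor is 1 / n, so an error eta / n for each entry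
   suffices. *)
have [N0 h] := avg_cvg_seq (fejer_freqs n) f (divr_gt0 eta0 n0R).
exists N0 => N N0N Np; rewrite fejer_meanE /fejer_sum -scalerBr -sumrB.
rewrite rnormZ rnorm_natV ler_pdivrMl// [leRHS]mulrC.
apply: le_trans (rnorm_sum _ _ _) _.
apply: le_trans (_ : \sum_(k <- fejer_freqs n) eta / n%:R <= _).
  rewrite big_seq [leRHS]big_seq; apply: ler_sum => k kr; exact: h.
rewrite big_const_seq count_predT iter_addr_0 size_allpairs size_iota subn0.
by rewrite mulrnA -[_ / _ *+ n]mulr_natr divfK ?gt_eqF// mulr_natr.
Qed.

Definition fejer_mass n N : R :=
  N%:R^-1 * \sum_(0 <= j < N) fejer n (cis (j%:R / N%:R)).

(* [fejer_mean n N] multiplies [e_0] by [fejer_mass n N] and tends to [e_0]. *)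
Lemma fejer_mass_cvg n (eta : R) : (0 < n)%N -> 0 < eta -> exists N0, forall N,
  (N0 <= N)%N -> (0 < N)%N -> `|fejer_mass n N - 1| <= eta.
Proof.
move=> n0 eta0; pose e0 := chi 0.
have e00 : 0 < rnorm e0.
  rewrite lt_neqAle rnorm_ge0 andbT; apply/eqP => /esym/rnorm_eq0 e00.
  by have := hat_chi_eq X 0; rewrite -/e0 e00 hat0 => /esym/eqP; rewrite oner_eq0.
have [N0 h] := fejer_mean_cvg e0 n0 (mulr_gt0 eta0 e00).
exists N0 => N N0N Np; have {h} := h N N0N Np.
have -> : fejer_mean n N e0 = (fejer_mass n N)%:C%C *: e0.
  rewrite /fejer_mean /fejer_mass rmorphM /= fmorphV /= rmorph_nat -scalerA.
  congr (_ *: _); rewrite rmorph_sum scaler_suml; apply: eq_bigr => j _ /=.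
  by rewrite tau_chi /character expr0z scale1r.
(* Only the [n] diagonal pairs a = b have a nonzero coefficient. *)
have -> : fejer_sum n e0 = e0.
  rewrite /fejer_sum big_allpairs_dep /= (eq_big_nat _ _ (F2 := fun=> e0)).
    rewrite sumr_const_nat subn0 -[e0 *+ n]scaler_nat scalerA mulVf ?scale1r//.
    by rewrite pnatr_eq0 -lt0n.
  move=> a an; rewrite (bigD1_seq a) ?mem_index_iota ?iota_uniq//=.
  rewrite subrr hat_chi_eq scale1r big1 ?addr0// => b ba.
  rewrite hat_chi subr_eq0 eqz_nat eq_sym (negbTE ba) scale0r.
  by [].
rewrite -{2}[e0]scale1r -scalerBl -(rmorphB _ _ 1) rnormZ rnormC.
by rewrite ler_pM2r.
Qed.

(** At nodes within [d] of 1 the translation moves [f] by at most [eta]; at the others the kernel is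
    at most 4 / (n d^2), and the translation moves [f] by at most twice its norm. *)
Lemma fejer_mean_dist n N f (eta d : R) : (0 < n)%N -> (0 < N)%N -> 0 < d ->
  (forall w, rnorm (circle_val w - 1) < d -> rnorm (tau w f - f) <= eta) ->
  rnorm (fejer_mean n N f - (fejer_mass n N)%:C%C *: f) <=
    fejer_mass n N * eta + 8 * rnorm f / (n%:R * d ^+ 2).
Proof.
move=> n0 Np d0 fd.
have eta0 : 0 <= eta.
  apply: le_trans (rnorm_ge0 _) (fd (circle1 R) _).
  by rewrite /= subrr rnorm0.
have -> : fejer_mean n N f - (fejer_mass n N)%:C%C *: f =
  (N%:R^-1 : R[i]) *: \sum_(0 <= j < N)
    (fejer n (cis (j%:R / N%:R)))%:C%C *: (tau (cis (j%:R / N%:R)) f - f).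
  rewrite /fejer_mean /fejer_mass rmorphM /= fmorphV /= rmorph_nat -scalerA -scalerBr.
  congr (_ *: _); rewrite rmorph_sum scaler_suml -sumrB; apply: eq_bigr => j _ /=.
  by rewrite scalerBr.
have N0R : 0 < N%:R :> R by rewrite ltr0n.
rewrite rnormZ rnorm_natV ler_pdivrMl// mulrDr mulrA mulVKf ?gt_eqF//.
apply: le_trans (rnorm_sum _ _ _) _.
have -> (c : R) : N%:R * c = \sum_(0 <= j < N) c.
  by rewrite sumr_const_nat subn0 mulr_natl.
rewrite mulr_suml -big_split /=.
apply: ler_sum => j _; rewrite rnormZ rnormC ger0_norm ?fejer_ge0//.
set w := cis _; have c0 : 0 <= 8 * rnorm f / (n%:R * d ^+ 2).
  by apply: divr_ge0; apply: mulr_ge0; rewrite ?rnorm_ge0// exprn_ge0// ltW.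
have [wd|wd] := ltP (rnorm (circle_val w - 1)) d.
  apply: le_trans (_ : fejer n w * eta <= _); last by rewrite lerDl.
  by apply: ler_wpM2l; [exact: fejer_ge0|exact: fd].
apply: le_trans (_ : 4 / (n%:R * d ^+ 2) * (2 * rnorm f) <= _).
  apply: ler_pM; rewrite ?fejer_ge0 ?rnorm_ge0 ?fejer_le//.
  by apply: le_trans (rnormD _ _) _; rewrite rnormN rnorm_tau mulr_natl mulr2n.
have -> : 4 / (n%:R * d ^+ 2) * (2 * rnorm f) = 8 * rnorm f / (n%:R * d ^+ 2) by ring.
by rewrite lerDr mulr_ge0// fejer_ge0.
Qed.

Lemma fejer_sum_cvg f (e : R) : 0 < e ->
  exists n, rnorm (fejer_sum n f - f) <= e.
Proof.
move=> e0; have f0 := rnorm_ge0 f.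
have [d d0 fd] := tau_continuous1 f (divr_gt0 e0 (ltr0n R 8)).
(* The error consists of four parts of e / 4. [n] makes the tail of the kernel small; [N], chosen
   after [n], brings the mean near the Fejér sum and the mass near 1 and at most 2. *)
pose n := (Num.truncn (32 * rnorm f / (e * d ^+ 2))).+1; exists n.
have nE : 8 * rnorm f / (n%:R * d ^+ 2) <= e / 4.
  have dd : 0 < d ^+ 2 by rewrite exprn_gt0.
  have := ltW (truncnS_gt (32 * rnorm f / (e * d ^+ 2))); rewrite -/n.
  rewrite !ler_pdivrMr ?mulr_gt0 ?ltr0n// => h.
  by nra.
have f10 : 0 < 4 * (rnorm f + 1) by rewrite mulr_gt0// ltr_wpDl.
have [N1 h1] := fejer_mean_cvg (n := n) f isT (divr_gt0 e0 (ltr0n R 4)).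
have [N2 h2] := fejer_mass_cvg (n := n) isT (divr_gt0 e0 f10).
have [N3 h3] := fejer_mass_cvg (n := n) isT ltr01.
pose N := (N1 + N2 + N3).+1.
have {}h1 := h1 N ltac:(lia) isT; have {}h2 := h2 N ltac:(lia) isT.
have {}h3 := h3 N ltac:(lia) isT.
have h4 := @fejer_mean_dist n N f (e / 8) d isT isT d0 fd.
have h5 : rnorm ((fejer_mass n N)%:C%C *: f - f) <= e / 4.
  rewrite -{2}[f]scale1r -scalerBl -(rmorphB _ _ 1) rnormZ rnormC.
  apply: le_trans (ler_wpM2r f0 h2) _; rewrite mulrAC ler_pdivrMr//.
  by nra.
have h6 : fejer_mass n N * (e / 8) <= e / 4.
  by move: h3; rewrite ler_norml => /andP[_ h3]; nra.
have {}h4 := le_trans h4 (lerD h6 nE).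
apply: le_trans (rnorm_dist _ (fejer_mean n N f) _) _.
have := rnorm_dist (fejer_mean n N f) ((fejer_mass n N)%:C%C *: f) f.
by rewrite (rnormB (fejer_sum n f)) => h7; lra.
Qed.

(** Repeated frequencies are merged and their multiplicity goes into [c]. The factor [hat q f] is
    kept visible so that frequencies outside the spectrum of [f] contribute nothing. *)
Lemma trig_poly_dense f (e : R) : 0 < e -> exists (r : seq int) (c : int -> R[i]),
  uniq r /\ rnorm (f - \sum_(q <- r) (c q * hat q f) *: chi q) <= e.
Proof.
move=> /(fejer_sum_cvg f)[n fn].
exists (undup (fejer_freqs n)).
exists (fun q => n%:R^-1 * (count_mem q (fejer_freqs n))%:R).
split; first exact: undup_uniq.
rewrite rnormB; move: fn; rewrite /fejer_sum -big_undup_iterop_count /=.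
rewrite scaler_sumr; congr (rnorm (_ - f) <= e); apply: eq_bigr => q _.
rewrite Monoid.iteropE iter_addr_0 -[_ *: _ *+ _]scaler_nat !scalerA; congr (_ *: _).
by rewrite mulrA.
Qed.

End fejer.

(** * Lacunary frequencies and multipliers *)

Section lacunary.
Variables (R : realType) (n : nat -> int).
Hypothesis hn : `|(n k.+1)%:~R / (n k)%:~R : R| @[k --> \oo] --> +oo.
Local Notation a k := (`|(n k)%:~R| : R).
Local Notation ev t := (circle_val (cis (t : R))).
Local Notation ch k := (@character R k).

Lemma lacunary_ratio (M : R) : 0 < M -> exists K, forall k, (K <= k)%N ->
  0 < a k /\ M * a k <= a k.+1.
Proof.
move=> M0; have /cvgryPge /(_ M) [K _ h] := hn; exists K => k Kk.
have := h k Kk; rewrite /= normrM normfV => Mk.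
(* Division by 0 gives 0, so a zero frequency would make the ratio 0, which is below [M]. *)
have ak : 0 < a k.
  rewrite lt_neqAle normr_ge0 andbT; apply/eqP => ak0.
  by move: Mk; rewrite -ak0 invr0 mulr0 leNgt M0.
by split => //; rewrite -ler_pdivlMr.
Qed.

(** A nonzero integer has modulus at least 1, so each doubling adds at least 1. *)
Lemma lacunary_growth K : (forall k, (K <= k)%N -> 0 < a k /\ 2 * a k <= a k.+1) ->
  forall i, i%:R <= a (K + i).
Proof.
move=> h; elim=> [|i IH]; first exact: normr_ge0.
have [a0 a2] := h (K + i)%N (leq_addr _ _).
have a1 : 1 <= a (K + i).
  have := a0; rewrite normr_gt0 intr_eq0 -absz_gt0 => n0.
  by rewrite -intr_norm -[1]/(1%:~R) ler_int -abszE lez_nat.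
by rewrite addnS -natr1; lra.
Qed.

(** The solutions [t] are spaced by 1 / |p|; rounding picks one near [t0]. *)
Lemma cis_near (p : int) (z : circle R) (t0 : R) : p != 0 ->
  exists t, cis (p%:~R * t) = z /\ `|t - t0| <= `|p%:~R|^-1.
Proof.
move=> p0; have [x ->] := cis_surj z.
have p0R : p%:~R != 0 :> R by rewrite intr_eq0.
pose fl := Num.floor (p%:~R * t0 - x).
have /andP[f1 f2] := floor_itv (p%:~R * t0 - x); rewrite -/fl in f1 f2.
exists ((x + fl%:~R) / p%:~R); split.
  by apply: circle_val_inj; rewrite mulrC divfK// cis_valD cis_val_int mulr1.
have -> : (x + fl%:~R) / p%:~R - t0 = (x + fl%:~R - p%:~R * t0) / p%:~R by field.
rewrite normrM normfV ler_piMl ?invr_ge0// ler_norml.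
by move: f2; rewrite intrD => f2; apply/andP; split; lra.
Qed.

(* The equations [cis (n_k t) = eps_k] are solved exactly one after the other;
   solving the next one moves [t] by at most [1 / a (k.+1)], hence [n_k t] by
   little. *)
Lemma lacunary_approx_step (M : R) K (eps : nat -> circle R) : 2 <= M ->
  (forall k, (K <= k)%N -> 0 < a k /\ M * a k <= a k.+1) ->
  forall L K' t0, (K <= K')%N -> exists t, `|t - t0| <= 2 / a K' /\
    forall k, (K' <= k < K' + L)%N ->
      rnorm (ev ((n k)%:~R * t) - circle_val (eps k)) <= 8 * pi / M.
Proof.
move=> M2 h; have M0 : 0 < M by lra.
elim=> [|L IH] K' t0 KK'; have [a0 aM] := h _ KK'.
  exists t0; split; first by rewrite subrr normr0 divr_ge0.
  by move=> k; rewrite addn0; lia.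
have n0 : n K' != 0 by move: a0; rewrite normr_gt0 intr_eq0.
have [t1 [t1E t1d]] := cis_near (eps K') t0 n0.
have [t [td tE]] := IH K'.+1 t1 (leqW KK').
(* Later corrections move [t] by at most 2 / (M a_K'). Since M >= 2 the total stays within 2 / a_K',
   and the equation already solved is disturbed by at most 8 pi / M. *)
have td' : `|t - t1| <= 2 / (M * a K').
  apply: le_trans td _; rewrite ler_wpM2l// lef_pV2 ?posrE ?mulr_gt0//.
  exact: lt_le_trans (mulr_gt0 M0 a0) aM.
have aV0 : 0 < (a K')^-1 by rewrite invr_gt0.
exists t; split.
  have -> : t - t0 = (t - t1) + (t1 - t0) by rewrite addrA subrK.
  apply: le_trans (ler_normD _ _) _.
  have : 2 / (M * a K') <= (a K')^-1.
    by rewrite invfM mulrA; apply: ler_piMl; rewrite ?(ltW aV0)// ler_pdivrMr// mul1r.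
  by lra.
move=> k; have [->|kK'] := eqVneq k K'; last by move=> hk; apply: tE; lia.
move=> _; rewrite -t1E; have := @cis_lip R ((n K')%:~R * t) ((n K')%:~R * t1).
rewrite rnormE lecR => hl; apply: le_trans hl _.
rewrite -mulrBr normrM.
have p0 : 0 <= 4 * pi * a K' :> R by rewrite !mulr_ge0// pi_ge0.
apply: le_trans (_ : 4 * pi * a K' * (2 / (M * a K')) <= _).
  by rewrite mulrA; exact: ler_wpM2l.
rewrite le_eqVlt; apply/orP; left; apply/eqP; field.
by rewrite !gt_eqF.
Qed.

(** The construction starts at t = 0, so |t| <= 2 / a_K, which leaves w^(n_j) near 1 as soon as M
    a_j <= a_K. *)
Lemma lacunary_approx (d : R) : 0 < d -> exists K0, forall K L (eps : nat -> circle R),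
  (K0 <= K)%N -> exists w, (forall j, (j < K)%N -> rnorm (ch (n j) w - 1) <= d) /\
    forall k, (K <= k < L)%N -> rnorm (ch (n k) w - circle_val (eps k)) <= d.
Proof.
move=> d0; have p0 : 0 < 8 * pi :> R by rewrite mulr_gt0// pi_gt0.
pose M : R := 2 + 8 * pi / d.
have q0 : 0 < 8 * pi / d by rewrite divr_gt0.
have M2 : 2 <= M by rewrite lerDl ltW.
have M0 : 0 < M by lra.
have Md : 8 * pi / M <= d.
  rewrite ler_pdivrMr//; have {1}-> : 8 * pi = 8 * pi / d * d by rewrite divfK ?gt_eqF.
  by rewrite mulrC ler_pM2l// lerDr.
have [K1 h] := lacunary_ratio M0.
have h2 k : (K1 <= k)%N -> 0 < a k /\ 2 * a k <= a k.+1.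
  move=> /h[a0 aM]; split => //; apply: le_trans aM.
  by rewrite ler_pM2r.
have gr := lacunary_growth h2.
(* [B] dominates M a_j for every j up to [K1], and [K0] is chosen so that a_K >= B. Larger j are
   handled by monotonicity. *)
pose B : R := M * \sum_(0 <= j < K1.+1) a j.
exists (K1 + (Num.truncn B).+1)%N => K L eps KK.
have K1K : (K1 < K)%N by lia.
have [aK0 _] := h K (ltnW K1K).
have aj j : (j < K)%N -> M * a j <= a K.
  move=> jK; have [jK1|jK1] := leqP j K1.
    apply: le_trans (_ : B <= _).
      rewrite ler_pM2l// (bigD1_seq j) ?iota_uniq ?mem_index_iota//= lerDl.
      by apply: sumr_ge0.
    have := gr (K - K1)%N; rewrite subnKC ?(ltnW K1K)// => /(le_trans _); apply.
    apply: le_trans (ltW (truncnS_gt _)) _.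
    by rewrite ler_nat leq_subRL ?(ltnW K1K).
  apply: le_trans (_ : M * a K.-1 <= _); last first.
    by have [_] := h K.-1 ltac:(lia); rewrite prednK//; lia.
  rewrite ler_pM2l//; have {jK} : (j <= K.-1)%N by lia.
  elim: (K.-1) => [|m IH]; first by rewrite leqn0 => /eqP ->.
  rewrite leq_eqVlt => /orP[/eqP -> //|]; rewrite ltnS => jm.
  apply: le_trans (IH jm) _; have [? ?] := h2 m ltac:(lia).
  by lra.
have [t [t0 tE]] := lacunary_approx_step eps M2 h (L - K) 0 (ltnW K1K).
exists (cis t); split=> [j jK|k kL]; rewrite /character -cis_val_intmul; last first.
  by apply: le_trans Md; apply: tE; lia.
apply: le_trans Md; have := @cis_lip R ((n j)%:~R * t) 0.
rewrite cis_val0 rnormE lecR !subr0 in t0 * => hl; apply: le_trans hl _.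
rewrite normrM ler_pdivlMr//.
apply: le_trans (_ : 4 * pi * (M * a j * `|t|) <= _).
  by rewrite le_eqVlt; apply/orP; left; apply/eqP; ring.
have -> : 8 * pi = 4 * pi * 2 :> R by ring.
rewrite ler_pM2l ?mulr_gt0 ?pi_gt0//.
apply: le_trans (_ : a K * `|t| <= _); first by rewrite ler_wpM2r// aj.
by rewrite mulrC -ler_pdivlMr.
Qed.

(** Values are prescribed by frequency instead of index, so repetitions in [n] do no harm; [L]
    bounds indices representing the finite list [s]. *)
Lemma lacunary_character (d : R) : 0 < d -> exists K0, forall K, (K0 <= K)%N ->
  forall (s : seq int) (eps : int -> circle R), {in s, forall q, range n q} ->
  (forall j, (j < K)%N -> eps (n j) = circle1 R) ->
  exists w, {in s, forall q, rnorm (ch q w - circle_val (eps q)) <= d}.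
Proof.
move=> d0; have [K0 h] := lacunary_approx d0; exists K0 => K KK s eps sn eps1.
have [L hL] : exists L, {in s, forall q, exists2 k, (k < L)%N & n k = q}.
  elim: s sn => [|q s IH] sn; first by exists 0%N.
  have [q' q's|L hL] := IH; first by apply: sn; rewrite inE q's orbT.
  have [k _ kq] := sn q (mem_head _ _).
  exists (maxn L k.+1) => p; rewrite inE => /orP[/eqP ->|/hL[l lL <-]].
    by exists k => //; lia.
  by exists l => //; lia.
have [w [w1 w2]] := h K L (eps \o n) KK; exists w => q /hL[k kL <-].
have [kK|Kk] := ltnP k K; first by rewrite eps1//; exact: w1.
by apply: w2; rewrite Kk.
Qed.

End lacunary.

(* The second clause keeps a multiplier that is 1 on an initial block of
   frequencies equal to 1 there after it is split into two unimodular ones. *)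
Lemma disc_mean_circle (R : realType) (z : R[i]) : rnorm z <= 1 ->
  exists p : circle R * circle R,
    z = 2^-1 * (circle_val p.1 + circle_val p.2) /\
    (z = 1 -> p = (circle1 R, circle1 R)).
Proof.
move=> z1; have [->|zn1] := eqVneq z 1.
  by exists (circle1 R, circle1 R); split => //=; field.
suff [p pE] : exists p : circle R * circle R,
    z = 2^-1 * (circle_val p.1 + circle_val p.2).
  by exists p; split => // z1'; rewrite z1' eqxx in zn1.
(* The numbers |z| + is and |z| - is are unimodular with mean |z|; both are then multiplied by the
   phase of [z], taken to be 1 when [z] is 0. *)
pose s := Num.sqrt (1 - rnorm z ^+ 2).
have sE : rnorm z ^+ 2 + s ^+ 2 = 1.
  by rewrite sqr_sqrtr ?subrKC// subr_ge0 expr_le1// rnorm_ge0.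
have h1 : `|(rnorm z +i* s)%C| = 1 by rewrite normc_def /= sE sqrtr1.
have h2 : `|(rnorm z -i* s)%C| = 1 by rewrite normc_def /= sqrrN sE sqrtr1.
have [u [u1 zu]] : exists u : R[i], `|u| = 1 /\ z = (rnorm z)%:C%C * u.
  have [->|z0] := eqVneq z 0; first by exists 1; rewrite normr1 rnorm0 mul0r.
  exists (z / (rnorm z)%:C%C); rewrite -rnormE normf_div normr_id divff ?normr_eq0//.
  by split => //; rewrite mulrC divfK// normr_eq0.
have e1 : `|u * (rnorm z +i* s)%C| = 1 by rewrite normrM u1 h1 mulr1.
have e2 : `|u * (rnorm z -i* s)%C| = 1 by rewrite normrM u1 h2 mulr1.
exists (circle_mk e1, circle_mk e2) => /=.
rewrite {1}zu /circle_val /= -mulrDr.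
have -> : ((rnorm z +i* s) + (rnorm z -i* s))%C = (rnorm z)%:C%C *+ 2 :> R[i].
  by apply/eqP; rewrite mulr2n eq_complex /= addr0 subrr !eqxx.
by rewrite -[_ *+ 2]mulr_natl; field.
Qed.

Lemma ler_sum_uniq_sub (R : numDomainType) (I : eqType) (s s' : seq I) (F : I -> R) :
  uniq s -> uniq s' -> {subset s <= s'} -> (forall i, 0 <= F i) ->
  \sum_(i <- s) F i <= \sum_(i <- s') F i.
Proof.
move=> us us' ss' F0; rewrite [leRHS](bigID (mem s)) /= -[leRHS]/(_ + _).
have -> : \sum_(i <- s) F i = \sum_(i <- s' | i \in s) F i.
  rewrite -[RHS]big_filter (perm_big [seq i <- s' | i \in s])//.
  apply: uniq_perm => //; first exact: filter_uniq.
  by move=> i; rewrite mem_filter andb_idr// => /ss'.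
by rewrite lerDl sumr_ge0.
Qed.

(** * Multipliers on polynomials with lacunary spectrum *)

Section multipliers.
Variables (R : realType) (X : homogeneousBanach R).
Local Notation tau := (hb_translate X).
Local Notation chi := (hb_character X).
Local Notation hat k f := (fourier k (hb_incl X f)).
Local Notation ch k := (@character R k).
Implicit Types (s : seq int) (a r : int -> R[i]) (w : circle R).

(** Coefficients [a] and multiplier [r] are kept apart so that estimates compare [r] with the
    constant multiplier 1, which gives the polynomial itself. *)
Definition trig_mult s a r : X := \sum_(q <- s) (r q * a q) *: chi q.

Lemma trig_mult_mean s a r (p : int -> circle R * circle R) :
  (forall q, r q = 2^-1 * (circle_val (p q).1 + circle_val (p q).2)) ->
  trig_mult s a r = 2^-1 *: (trig_mult s a (fun q => circle_val (p q).1) +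
                         trig_mult s a (fun q => circle_val (p q).2)).
Proof.
move=> rE; rewrite /trig_mult -big_split /= scaler_sumr; apply: eq_bigr => q _.
by rewrite -scalerDl -mulrDl scalerA mulrA -rE.
Qed.

Lemma trig_mult_split s a r r' :
  trig_mult s a r = trig_mult s a r' + trig_mult s a (fun q => r q - r' q).
Proof.
rewrite /trig_mult -big_split /=; apply: eq_bigr => q _.
by rewrite -scalerDl -mulrDl addrC subrK.
Qed.

Lemma trig_multZ s a r (c : R[i]) :
  trig_mult s a (fun q => c * r q) = c *: trig_mult s a r.
Proof.
by rewrite /trig_mult scaler_sumr; apply: eq_bigr => q _; rewrite scalerA mulrA.
Qed.

Lemma trig_mult_tau s a w :
  trig_mult s a (fun q => ch q w) = tau w (trig_mult s a (fun=> 1)).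
Proof.
rewrite /trig_mult tau_sum; apply: eq_bigr => q _.
by rewrite tauZ tau_chi mul1r scalerA mulrC.
Qed.

Lemma rnorm_trig_mult_mean s a r (c : R) (p : int -> circle R * circle R) :
  (forall q, r q = 2^-1 * (circle_val (p q).1 + circle_val (p q).2)) ->
  rnorm (trig_mult s a (fun q => circle_val (p q).1)) <= c ->
  rnorm (trig_mult s a (fun q => circle_val (p q).2)) <= c ->
  rnorm (trig_mult s a r) <= c.
Proof.
move=> rE h1 h2; rewrite (trig_mult_mean _ _ rE) rnormZ (rnorm_natV R 2).
by rewrite ler_pdivrMl//; apply: le_trans (rnormD _ _) _; lra.
Qed.

Lemma disc_mean_circle_fun r : (forall q, rnorm (r q) <= 1) ->
  exists p : int -> circle R * circle R, forall q,
    r q = 2^-1 * (circle_val (p q).1 + circle_val (p q).2) /\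
    (r q = 1 -> p q = (circle1 R, circle1 R)).
Proof.
move=> r1; have /choice[p pE] := fun q => disc_mean_circle (r1 q).
by exists p.
Qed.

(* If [S] is the supremum of the left-hand side over all [r], comparison with
   a translation bounds [S] by the norm on the right plus [S / 2]. *)
Lemma trig_mult_approx_le s a :
  (forall eps : int -> circle R, exists w,
    {in s, forall q, rnorm (ch q w - circle_val (eps q)) <= 2^-1}) ->
  forall r, (forall q, rnorm (r q) <= 1) ->
  rnorm (trig_mult s a r) <= 2 * rnorm (trig_mult s a (fun=> 1)).
Proof.
move=> ap; set P1 := rnorm (trig_mult s a (fun=> 1)).
pose A := [set rnorm (trig_mult s a r) | r in [set r | forall q, rnorm (r q) <= 1]].
have A0 : A !=set0.
  exists (rnorm (trig_mult s a (fun=> 0))), (fun=> 0) => //= q.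
  by rewrite rnorm0.
(* The triangle inequality makes the supremum S finite, so that S <= P1 + S / 2 can be solved for
   S. *)
have ubA : has_ubound A.
  exists (\sum_(q <- s) rnorm (a q *: chi q)) => _ [r r1 <-].
  apply: le_trans (rnorm_sum _ _ _) _; apply: ler_sum => q _.
  by rewrite -scalerA rnormZ ler_piMl ?rnorm_ge0.
suff S2 : sup A <= P1 + 2^-1 * sup A.
  move=> r r1; apply: le_trans (_ : sup A <= _); last by lra.
  by apply: ub_le_sup => //; exists r.
apply: ge_sup => // _ [r r1 <-].
have [p pE] := disc_mean_circle_fun r1.
suff h (eps : int -> circle R) :
    rnorm (trig_mult s a (fun q => circle_val (eps q))) <= P1 + 2^-1 * sup A.
  by apply: (rnorm_trig_mult_mean (p := p)) => [q||]; [have [] := pE q|exact: h|exact: h].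
have [w wE] := ap eps.
rewrite (trig_mult_split _ _ _ (fun q => ch q w)) trig_mult_tau.
apply: le_trans (rnormD _ _) _; rewrite rnorm_tau lerD2l.
(* Twice the error is again a multiplier of modulus at most 1; outside [s], where the error is not
   controlled, it is set to 0. *)
pose r' q := if q \in s then 2 * (circle_val (eps q) - ch q w) else 0.
have -> : trig_mult s a (fun q => circle_val (eps q) - ch q w) = 2^-1 *: trig_mult s a r'.
  rewrite -trig_multZ /trig_mult big_seq [RHS]big_seq; apply: eq_bigr => q qs.
  by rewrite /r' qs mulKf.
rewrite rnormZ (rnorm_natV R 2) ler_pM2l ?invr_gt0//.
apply: ub_le_sup => //; exists r' => //= q; rewrite /r'; case: ifPn => [qs|_].
  rewrite rnormM rnormB.
  have := wE q qs; have : rnorm (2 : R[i]) = 2.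
    by rewrite (_ : 2 = (2 : R)%:C%C) ?rnormC ?ger0_norm// rmorph_nat.
  by move=> ->; lra.
by rewrite rnorm0.
Qed.

Lemma hat_trig_mult s a q : uniq s -> q \in s -> hat q (trig_mult s a (fun=> 1)) = a q.
Proof.
move=> us qs; rewrite hat_sum (bigD1_seq q)//= hatZ hat_chi_eq mul1r mulr1.
rewrite big1 ?addr0// => p pq; rewrite hatZ hat_chi eq_sym (negbTE pq).
by rewrite mulr0.
Qed.

Lemma rnorm_coef_le s a q : uniq s -> q \in s ->
  rnorm (a q) <= 2 * rnorm (trig_mult s a (fun=> 1)).
Proof. by move=> us qs; rewrite -{1}(hat_trig_mult a us qs) hat_le. Qed.

Variable n : nat -> int.
Hypothesis hn : `|(n k.+1)%:~R / (n k)%:~R : R| @[k --> \oo] --> +oo.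

(** The finitely many frequencies in [F] are controlled through their coefficients, the others by
    [trig_mult_approx_le]. *)
Lemma lacunary_unconditional : exists2 C : R, 0 <= C &
  forall s a r (d : R), uniq s -> {in s, forall q, range n q} -> 0 < d ->
  {in s, forall q, rnorm (r q) <= d} ->
  rnorm (trig_mult s a r) <= C * d * rnorm (trig_mult s a (fun=> 1)).
Proof.
have d20 : 0 < 2^-1 :> R by rewrite invr_gt0.
have [K0 h] := lacunary_character hn d20.
pose F := [seq n j | j <- iota 0 K0].
pose C1 := \sum_(q <- undup F) rnorm (chi q).
have C10 : 0 <= C1 by apply: sumr_ge0 => q _; exact: rnorm_ge0.
(* The term [2 * C1] pays for the part in [F]; [1 + 2 * C1] bounds the rest of the polynomial, and
   [trig_mult_approx_le] doubles it. *)
exists (2 * C1 + 2 * (1 + 2 * C1)); first by lra.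
move=> s a r d us sn d0 rd; set P1 := rnorm (trig_mult s a (fun=> 1)).
have P10 : 0 <= P1 by exact: rnorm_ge0.
pose sF := [seq q <- s | q \in F]; pose sT := [seq q <- s | q \notin F].
have split r' : trig_mult s a r' = trig_mult sF a r' + trig_mult sT a r'.
  by rewrite /trig_mult !big_filter (bigID (fun q => q \in F)).
have boundF r' (c : R) : 0 <= c -> {in s, forall q, rnorm (r' q) <= c} ->
    rnorm (trig_mult sF a r') <= 2 * C1 * c * P1.
  move=> c0 rc; apply: le_trans (rnorm_sum _ _ _) _.
  apply: le_trans (_ : \sum_(q <- sF) c * (2 * P1) * rnorm (chi q) <= _).
    rewrite big_seq [leRHS]big_seq; apply: ler_sum => q.
    rewrite mem_filter => /andP[_ qs]; rewrite rnormZ rnormM.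
    apply: ler_wpM2r; first exact: rnorm_ge0.
    by apply: ler_pM; rewrite ?rnorm_ge0 ?rc// rnorm_coef_le.
  rewrite -mulr_sumr.
  have -> : 2 * C1 * c * P1 = c * (2 * P1) * C1 by ring.
  apply: ler_wpM2l; first by rewrite mulr_ge0// mulr_ge0.
  apply: ler_sum_uniq_sub; [exact: filter_uniq|exact: undup_uniq| |].
    by move=> q; rewrite mem_filter mem_undup => /andP[].
  by move=> q; exact: rnorm_ge0.
have boundT r' : (forall q, rnorm (r' q) <= 1) ->
    rnorm (trig_mult sT a r') <= 2 * rnorm (trig_mult sT a (fun=> 1)).
  apply: trig_mult_approx_le => eps.
  (* [lacunary_character] asks for the value 1 on [F]; this costs nothing since [sT] avoids [F]. *)
  pose eps' q := if q \in F then circle1 R else eps q.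
  have [||w wE] := h K0 (leqnn _) sT eps'.
  - by move=> q; rewrite mem_filter => /andP[_]; exact: sn.
  - by move=> j jK; rewrite /eps' map_f// mem_iota.
  exists w => q qs; have := wE q qs; rewrite /eps'.
  by move: qs; rewrite mem_filter => /andP[/negbTE ->].
have T1 : rnorm (trig_mult sT a (fun=> 1)) <= (1 + 2 * C1) * P1.
  have -> : trig_mult sT a (fun=> 1) = trig_mult s a (fun=> 1) - trig_mult sF a (fun=> 1).
    by rewrite split addrC addKr.
  apply: le_trans (rnormD _ _) _; rewrite rnormN mulrDl mul1r lerD2l.
  apply: le_trans (boundF (fun=> 1) 1 ler01 _) _; last by rewrite mulr1.
  by move=> q _; rewrite /rnorm normr1.
(* Rescaled to the unit disc; the bound on [r] holds on [s] only, hence the value 0 elsewhere. *)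
pose r' q := if q \in s then (d^-1)%:C%C * r q else 0.
have r'1 q : rnorm (r' q) <= 1.
  rewrite /r'; case: ifPn => [qs|_]; last by rewrite rnorm0.
  by rewrite rnormM rnormC gtr0_norm ?invr_gt0// ler_pdivrMl// mulr1 rd.
have rT : rnorm (trig_mult sT a r) <= d * (2 * ((1 + 2 * C1) * P1)).
  have -> : trig_mult sT a r = (d%:C)%C *: trig_mult sT a r'.
    rewrite -trig_multZ /trig_mult big_seq [RHS]big_seq; apply: eq_bigr => q.
    rewrite mem_filter => /andP[_ qs]; rewrite /r' qs mulrA -rmorphM /=.
    by rewrite mulfV ?gt_eqF// mul1r.
  rewrite rnormZ rnormC gtr0_norm// ler_pM2l//.
  by apply: le_trans (boundT _ r'1) _; rewrite ler_pM2l.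
rewrite split; apply: le_trans (rnormD _ _) _.
have := boundF r d (ltW d0) rd; lra.
Qed.

Lemma lacunary_multiplier (e : R) : 0 < e -> exists K, forall r,
  (forall q, rnorm (r q) <= 1) -> (forall j, (j < K)%N -> r (n j) = 1) ->
  forall s a, uniq s -> {in s, forall q, range n q} ->
  rnorm (trig_mult s a r) <= (1 + e) * rnorm (trig_mult s a (fun=> 1)).
Proof.
move=> e0; have [C C0 uncond] := lacunary_unconditional.
have C10 : 0 < C + 1 by lra.
(* With this [d], the remainder after translation costs a factor C d <= e. *)
have d0 : 0 < e / (C + 1) by rewrite divr_gt0.
have [K h] := lacunary_character hn d0; exists K => r r1 rK s a us sn.
have [p pE] := disc_mean_circle_fun r1.
set P1 := rnorm (trig_mult s a (fun=> 1)).
have P10 : 0 <= P1 by exact: rnorm_ge0.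
(* Where [r] is 1, both unimodular functions are 1, so the condition on the first [K] frequencies
   passes to them. *)
suff H (eps : int -> circle R) : (forall j, (j < K)%N -> eps (n j) = circle1 R) ->
    rnorm (trig_mult s a (fun q => circle_val (eps q))) <= (1 + e) * P1.
  apply: (rnorm_trig_mult_mean (p := p)); first by move=> q; have [] := pE q.
  - by apply: H => j jK; have [_ ->] := pE (n j); rewrite ?rK.
  - by apply: H => j jK; have [_ ->] := pE (n j); rewrite ?rK.
move=> epsK; have [w wE] := h K (leqnn _) s eps sn epsK.
rewrite (trig_mult_split _ _ _ (fun q => ch q w)) trig_mult_tau.
apply: le_trans (rnormD _ _) _; rewrite rnorm_tau mulrDl mul1r lerD2l.
apply: le_trans (uncond s a _ _ us sn d0 _) _.
  by move=> q qs; rewrite rnormB; exact: wE.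
apply: ler_wpM2r => //; rewrite mulrCA ler_piMr ?(ltW e0)//.
by rewrite ler_pdivrMr// mul1r; lra.
Qed.

Lemma lacunary_metric_unconditional : metric_unconditional_basic_seq X (range n).
Proof.
move=> e e0; have [K h] := lacunary_multiplier e0.
pose F := [seq n j | j <- iota 0 K].
exists [set` F]; first exact: finite_seq.
move=> G a eps GF; rewrite !rnormE -rmorphM lecR /=.
(* The value 1 on [F] meets the condition of [lacunary_multiplier]; [G] avoids [F], so the sum is
   unchanged. *)
pose r q : R[i] := if q \in F then 1 else circle_val (eps q).
have r1 q : rnorm (r q) <= 1.
  by rewrite /r; case: ifP => _; rewrite ?rnorm_circle// /rnorm normr1.
have rK j : (j < K)%N -> r (n j) = 1 by move=> jK; rewrite /r map_f// mem_iota.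
have sn : {in G, forall q, range n q} by move=> q /GF[].
have := h r r1 rK G a (fset_uniq G) sn; rewrite /trig_mult.
under [in leRHS]eq_bigr do rewrite mul1r.
congr (rnorm _ <= _); rewrite big_seq [RHS]big_seq; apply: eq_bigr => q qG.
by have [_ /negP] := GF q qG; rewrite /r => /negbTE ->.
Qed.

End multipliers.

(** * Unconditional approximation *)

Section spectral_projections.
Variables (R : realType) (X : homogeneousBanach R) (E : set int).
Local Notation Y := (spectral X E).
Local Notation chi := (hb_character X).
Local Notation hat k f := (fourier k (hb_incl X f)).
Local Notation v y := (spectral_val (y : Y)).
Implicit Types (y z : Y) (t s : seq int).

Lemma spectral_valD y z : v (y + z) = v y + v z. Proof. by []. Qed.
Lemma spectral_valB y z : v (y - z) = v y - v z. Proof. by []. Qed.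
Lemma spectral_valZ (a : R[i]) y : v (a *: y) = a *: v y. Proof. by []. Qed.
Lemma spectral_val_sum (I : Type) (s : seq I) (F : I -> Y) :
  v (\sum_(i <- s) F i) = \sum_(i <- s) v (F i).
Proof. exact: (big_morph _ spectral_valD). Qed.
Lemma rnorm_spectral y : rnorm y = rnorm (v y). Proof. by []. Qed.

(* Equal to 0 when [q] is not in [E]. *)
Definition schi (q : int) : Y := insubd (0 : Y) (chi q).

Lemma schiE q : E q -> v (schi q) = chi q.
Proof.
move=> Eq; rewrite /schi; apply: insubdK; apply/asboolP => k Ek.
by rewrite hat_chi; case: eqVneq Ek => // ->.
Qed.

Lemma hat_spectral y q : ~ E q -> hat q (v y) = 0.
Proof. by move=> Eq; have /asboolP := spectralP y; apply. Qed.

Definition fourier_psum t y : Y := \sum_(q <- t) hat q (v y) *: schi q.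

Lemma fourier_psum_linear t : linear (fourier_psum t).
Proof.
move=> a y z; rewrite /fourier_psum scaler_sumr -big_split /=; apply: eq_bigr => q _.
by rewrite hat_linear scalerDl scalerA.
Qed.

HB.instance Definition _ t :=
  GRing.isLinear.Build R[i] Y Y _ (fourier_psum t) (fourier_psum_linear t).

Lemma fourier_psumB t y z : fourier_psum t (y - z) = fourier_psum t y - fourier_psum t z.
Proof. exact: linearB. Qed.

Definition fourier_psum_cst t : R := \sum_(q <- t) 2 * rnorm (schi q).

Lemma fourier_psum_cst_ge0 t : 0 <= fourier_psum_cst t.
Proof. by apply: sumr_ge0 => q _; rewrite mulr_ge0// rnorm_ge0. Qed.

Lemma fourier_psum_bound t y : rnorm (fourier_psum t y) <= fourier_psum_cst t * rnorm y.
Proof.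
apply: le_trans (rnorm_sum _ _ _) _; rewrite mulr_suml; apply: ler_sum => q _.
rewrite rnormZ mulrAC; apply: ler_wpM2r; first exact: rnorm_ge0.
exact: hat_le.
Qed.

Lemma fourier_psum_finite_rank t : finite_rank (fourier_psum t).
Proof.
exists (size t), (fun i => schi (nth 0 t i)) => y.
exists (fun i => hat (nth 0 t i) (v y)).
by rewrite /fourier_psum (big_nth 0) big_mkord.
Qed.

Definition spoly s (b : int -> R[i]) : Y := \sum_(q <- s) b q *: schi q.

Lemma spolyE s b : {in s, forall q, E q} -> v (spoly s b) = trig_mult X s b (fun=> 1).
Proof.
move=> sE; rewrite spectral_val_sum /trig_mult big_seq [RHS]big_seq; apply: eq_bigr => q qs.
by rewrite spectral_valZ mul1r schiE//; exact: sE.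
Qed.

Lemma fourier_psum_spoly s t b : {in s, forall q, E q} -> {in t, forall q, E q} ->
  uniq s -> uniq t ->
  v (fourier_psum t (spoly s b)) = trig_mult X s b (fun q => (q \in t)%:R).
Proof.
move=> sE tE us ut; rewrite spectral_val_sum /trig_mult.
have -> : \sum_(q <- t) v (hat q (v (spoly s b)) *: schi q) =
    \sum_(q <- t) \sum_(p <- s) ((q == p)%:R * b p) *: chi p.
  rewrite big_seq [RHS]big_seq; apply: eq_bigr => q qt.
  rewrite spectral_valZ schiE; last exact: tE.
  rewrite spolyE// /trig_mult hat_sum scaler_suml; apply: eq_bigr => p _.
  rewrite hatZ hat_chi mul1r mulrC; case: eqVneq => [->|_] //.
  by rewrite mul0r !scale0r.
rewrite exchange_big /=; apply: eq_bigr => p _.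
rewrite -scaler_suml -mulr_suml; congr ((_ * _) *: _).
case: (boolP (p \in t)) => pt; last first.
  rewrite big_seq big1// => q qt; case: eqVneq => // qp.
  by rewrite -qp qt in pt.
rewrite (bigD1_seq p)//= eqxx big1 ?addr0// => q /negbTE -> //.
Qed.

Lemma spoly_dense y (e : R) : 0 < e -> exists s b,
  [/\ uniq s, {in s, forall q, E q} & rnorm (y - spoly s b) <= e].
Proof.
move=> /(trig_poly_dense (v y))[r [c [ur h]]].
exists [seq q <- r | `[< E q >]], (fun q => c q * hat q (v y)).
have sE : {in [seq q <- r | `[< E q >]], forall q, E q}.
  by move=> q; rewrite mem_filter => /andP[/asboolP].
split => //; first exact: filter_uniq.
rewrite rnorm_spectral spectral_valB spolyE// /trig_mult big_filter.
rewrite (bigID (fun q => `[< E q >])) /= in h.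
have h0 : \sum_(q <- r | ~~ `[< E q >]) (c q * hat q (v y)) *: chi q = 0.
  by apply: big1 => q /asboolP Eq; rewrite (hat_spectral _ Eq) mulr0 scale0r.
by rewrite h0 addr0 in h; under eq_bigr do rewrite mul1r.
Qed.

Lemma rat_approx (c : R[i]) (e : R) : 0 < e -> exists p : rat * rat,
  rnorm (c - (ratr p.1 +i* ratr p.2)%C) <= e.
Proof.
case: c => x y e0.
have H (u : R) : exists p : rat, `|u - ratr p| <= e / 2.
  have [|p] := @rat_in_itvoo R (u - e / 2) (u + e / 2); first by lra.
  rewrite in_itv /= => /andP[p1 p2]; exists p.
  by rewrite ler_norml; apply/andP; split; lra.
have [p pE] := H x; have [q qE] := H y; exists (p, q) => /=.
rewrite -lecR -rnormE; apply: le_trans (normc_le _ _) _.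
by rewrite lecR /=; lra.
Qed.

End spectral_projections.

(** * Separability and the approximating sequence *)

Section lacunary_umap.
Variables (R : realType) (X : homogeneousBanach R) (n : nat -> int).
Hypothesis hn : `|(n k.+1)%:~R / (n k)%:~R : R| @[k --> \oo] --> +oo.
Local Notation E := (range n).
Local Notation Y := (spectral X E).
Local Notation v y := (spectral_val (y : Y)).

Definition rat_comb (l : seq (nat * (rat * rat))) : Y :=
  \sum_(p <- l) (ratr p.2.1 +i* ratr p.2.2)%C *: schi X E (n p.1).

Lemma spectral_separable : separable Y.
Proof.
exists (range rat_comb).
  exact: sub_countable (card_image_le _ _) (countableP _).
move=> O [y Oy] oO.
have /nbhs_ballP[e /ltc_real_gt0[r r0 ->] rO] : nbhs y O.
  by apply: open_nbhs_nbhs.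
have [s [b [us sE sb]]] := spoly_dense y (divr_gt0 r0 (ltr0n R 4)).
have [l lE] : exists l, rnorm (spoly X E s b - rat_comb l) <= r / 4.
  have : 0 < r / 4 by rewrite divr_gt0.
  move: (r / 4) => d.
  (* The tolerance is halved at each frequency, so the induction is general in [d]. *)
  elim: s sE {us sb} d => [|q s IH] sE d d0.
    by exists [::]; rewrite /spoly /rat_comb !big_nil subr0 rnorm0 ltW.
  have d20 : 0 < d / 2 by rewrite divr_gt0.
  have [q' q's|l lE] := IH _ (d / 2) d20; first by apply: sE; rewrite inE q's orbT.
  have [k _ kq] := sE q (mem_head _ _).
  have c0 : 0 < rnorm (schi X E q) + 1 by rewrite ltr_wpDl// rnorm_ge0.
  have [p pE] := rat_approx (b q) (divr_gt0 d20 c0).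
  exists ((k, p) :: l); rewrite /spoly /rat_comb !big_cons /= kq opprD addrACA.
  apply: le_trans (rnormD _ _) _; rewrite [leRHS]splitr lerD// -scalerBl rnormZ.
  apply: le_trans (_ : d / 2 / (rnorm (schi X E q) + 1) * (rnorm (schi X E q) + 1) <= _).
    by apply: ler_pM; rewrite ?rnorm_ge0// lerDl.
  by rewrite divfK// gt_eqF.
exists (rat_comb l); split; last by exists l.
apply: rO; rewrite -ball_normE /= rnormE ltcR.
apply: le_lt_trans (rnorm_dist _ (spoly X E s b) _) _; lra.
Qed.

(* [b k] says that a given frequency has entered the [k]-th stage. *)
Lemma chain_sum (b : nat -> bool) (eps : nat -> R[i]) (m : nat) : b 0%N = false ->
  (forall k, b k -> b k.+1) ->
  let S := \sum_(1 <= k < m.+1) eps k * ((b k)%:R - (b k.-1)%:R) in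
  if b m then exists2 k, (0 < k)%N && ~~ b k.-1 & S = eps k else S = 0.
Proof.
move=> b0 bS; elim: m => [|m IH] /=; first by rewrite b0 big_geq.
rewrite big_nat_recr//=; case: (boolP (b m)) => bm.
  rewrite bS// subrr mulr0 addr0; move: IH; by rewrite /= bm.
move: IH; rewrite /= (negbTE bm) => ->; rewrite add0r subr0.
case: (b m.+1); last by rewrite mulr0.
by exists m.+1 => //; rewrite mulr1.
Qed.

(* The frequencies seen by [T_k]: none for [k = 0], and the first block
   [n 0, ..., n K.-1] already for [k = 1]. *)
Definition stage K k : seq int :=
  if k is k'.+1 then undup [seq n j | j <- iota 0 (K + k')] else [::].

Lemma stage_uniq K k : uniq (stage K k).
Proof. by case: k => // k; exact: undup_uniq. Qed.

Lemma stage_range K k : {in stage K k, forall q, E q}.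
Proof. by case: k => // k q; rewrite mem_undup => /mapP[j _ ->]; exists j. Qed.

Lemma stage_sub K k q : q \in stage K k -> q \in stage K k.+1.
Proof.
case: k => // k; rewrite !mem_undup => /mapP[j]; rewrite mem_iota => jK ->.
by apply: map_f; rewrite mem_iota; lia.
Qed.

Lemma stage_mem K k j : (j < K + k)%N -> n j \in stage K k.+1.
Proof. by move=> jK; rewrite mem_undup map_f// mem_iota. Qed.

Definition twist K (eps : nat -> circle R) m (y : Y) : Y :=
  \sum_(1 <= k < m.+1)
    circle_val (eps k) *: (fourier_psum (stage K k) y - fourier_psum (stage K k.-1) y).

Lemma twistB K eps m y z : twist K eps m (y - z) = twist K eps m y - twist K eps m z.
Proof.
rewrite /twist -sumrB; apply: eq_bigr => k _.
rewrite -scalerBr; congr (_ *: _); rewrite !fourier_psumB.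
by rewrite !opprD !opprK addrACA.
Qed.

(** A crude bound, used to extend the sharp estimate from polynomials to their closure. *)
Lemma twist_bounded K eps m : exists2 B : R, 0 <= B &
  forall y, rnorm (twist K eps m y) <= B * rnorm y.
Proof.
exists (\sum_(1 <= k < m.+1)
    (fourier_psum_cst X E (stage K k) + fourier_psum_cst X E (stage K k.-1))).
  by apply: sumr_ge0 => k _; rewrite addr_ge0 ?fourier_psum_cst_ge0.
move=> y; apply: le_trans (rnorm_sum _ _ _) _; rewrite mulr_suml.
apply: ler_sum => k _; rewrite rnormZ rnorm_circle mul1r mulrDl.
by apply: le_trans (rnormD _ _) _; rewrite rnormN lerD ?fourier_psum_bound.
Qed.

Lemma twist_spoly K eps m s b : {in s, forall q, E q} -> uniq s ->
  v (twist K eps m (spoly X E s b)) =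
  trig_mult X s b (fun q => \sum_(1 <= k < m.+1) circle_val (eps k) *
    ((q \in stage K k)%:R - (q \in stage K k.-1)%:R)).
Proof.
move=> sE us; rewrite spectral_val_sum.
have pE k : v (fourier_psum (stage K k) (spoly X E s b)) =
    trig_mult X s b (fun q => (q \in stage K k)%:R).
  by apply: fourier_psum_spoly => //; [exact: stage_range|exact: stage_uniq].
under eq_bigr do rewrite spectral_valZ spectral_valB !pE.
rewrite /trig_mult; under eq_bigr do rewrite -sumrB scaler_sumr.
rewrite exchange_big /=; apply: eq_bigr => q _.
rewrite mulr_suml scaler_suml; apply: eq_bigr => k _.
by rewrite -scalerBl scalerA -mulrBl mulrA.
Qed.

(** On polynomials [twist] is a multiplier: its value is [eps k] at a frequency entering at stage
    [k] <= [m], and 0 at one not yet entered. *)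
Lemma twist_le (e : R) : 0 < e -> exists K, forall eps m y,
  rnorm (twist K eps m y) <= (1 + e) * rnorm y.
Proof.
move=> e0; have [K h] := lacunary_multiplier X hn e0; exists K => eps m y.
have poly_le s b : {in s, forall q, E q} -> uniq s ->
    rnorm (twist K eps m (spoly X E s b)) <= (1 + e) * rnorm (spoly X E s b).
  move=> sE us; case: m => [|m].
    rewrite /twist big_geq// rnorm0 mulr_ge0 ?rnorm_ge0//; lra.
  rewrite rnorm_spectral twist_spoly// rnorm_spectral spolyE//.
  set r := (X in trig_mult _ _ _ X).
  have rP q := @chain_sum (fun k => q \in stage K k)
    (fun k => circle_val (eps k)) m.+1 erefl (fun k => @stage_sub K k q).
  (* The whole first block enters at stage 1, where the multiplier equals [u]; dividing by [u] makes
     it 1 there, as [lacunary_multiplier] requires. *)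
  pose u := circle_val (eps 1%N).
  have u0 : u != 0 by exact: circle_val_neq0.
  have -> : r = fun q => u * (u^-1 * r q).
    by apply/funext => q; rewrite mulrA divff// mul1r.
  rewrite trig_multZ rnormZ rnorm_circle mul1r; apply: h => // [q|j jK].
    rewrite rnormM; have -> : rnorm u^-1 = 1.
      by rewrite /rnorm normfV normr_circle invr1.
    rewrite mul1r; have := rP q; rewrite /= -/(r q).
    by case: ifP => _ => [[k _ ->]|->]; rewrite ?rnorm_circle// rnorm0.
  have j1 k : n j \in stage K k.+1 by apply: stage_mem; lia.
  have := rP (n j); rewrite /= -/(r (n j)) j1 => -[k /andP[k0 kj] ->].
  case: k k0 kj => // -[|k] _ /=; last by rewrite j1.
  by move=> _; rewrite mulVf.
(* Density carries the estimate to [y]: replacing [y] by a polynomial costs at most B + 1 + e times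
   their distance. *)
have [B B0 hB] := twist_bounded K eps m.
apply/ler_addgt0Pr => d d0.
have c0 : 0 < B + 1 + e + 1 by lra.
have [s [b [us sE sb]]] := spoly_dense y (divr_gt0 d0 c0).
set P := spoly X E s b in sb *; set g := rnorm (y - P) in sb.
have g0 : 0 <= g by exact: rnorm_ge0.
have -> : twist K eps m y = twist K eps m (y - P) + twist K eps m P.
  by rewrite twistB subrK.
apply: le_trans (rnormD _ _) _.
have h1 := hB (y - P); rewrite -/g in h1.
have h2 := poly_le s b sE us; rewrite -/P in h2.
have h3 : rnorm P <= rnorm y + g.
  by have := rnorm_dist P y 0; rewrite !subr0 rnormB -/g addrC.
have h4 : g * (B + 1 + e + 1) <= d by rewrite -ler_pdivlMr.
have h5 : (1 + e) * rnorm P <= (1 + e) * (rnorm y + g) by rewrite ler_pM2l//; lra.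
nra.
Qed.

(** The sum telescopes, so the bound on [twist] also bounds the projections uniformly. *)
Lemma twist1 K m y : twist K (fun=> circle1 R) m y = fourier_psum (stage K m) y.
Proof.
elim: m => [|m IH]; first by rewrite /twist big_geq// /fourier_psum big_nil.
rewrite /twist big_nat_recr//= -/(twist _ _ _ _) IH.
by rewrite (_ : circle_val (circle1 R) = 1)// scale1r addrC subrK.
Qed.

Lemma stage_cover K (s : seq int) : {in s, forall q, E q} ->
  exists k0, forall k, (k0 <= k)%N -> {subset s <= stage K k}.
Proof.
elim: s => [|q s IH] sE; first by exists 0%N.
have [q' q's|k0 h] := IH; first by apply: sE; rewrite inE q's orbT.
have [j _ jq] := sE q (mem_head _ _).
(* [K] may be 0, and then the index [j] is covered only from stage j + 2 on. *)
exists (maxn k0 j.+2) => -[|k]; first by lia.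
move=> kk p; rewrite inE => /orP[/eqP ->|ps].
  by rewrite -jq; apply: stage_mem; lia.
by apply: h => //; lia.
Qed.

(** The projections are uniformly bounded by 1 + e and eventually fix each polynomial with
    frequencies in [E]; such polynomials are dense. *)
Lemma fourier_psum_stage_cvg K (e : R) : 0 < e ->
  (forall eps m y, rnorm (twist K eps m y) <= (1 + e) * rnorm y) ->
  forall y : Y, fourier_psum (stage K k) y @[k --> \oo] --> y.
Proof.
move=> e0 tw y; apply/cvgrPdist_le => d /ltc_real_gt0[r r0 ->].
have c0 : 0 < 2 + e by lra.
have [s [b [us sE sb]]] := spoly_dense y (divr_gt0 r0 c0).
have [k0 hk] := stage_cover K sE.
exists k0 => // k /= k0k; rewrite rnormE lecR rnormB.
set P := spoly X E s b in sb.
have PE : fourier_psum (stage K k) P = P.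
  apply: val_inj; rewrite [LHS]fourier_psum_spoly ?stage_uniq//; last exact: stage_range.
  rewrite [RHS]spolyE// /trig_mult big_seq [RHS]big_seq; apply: eq_bigr => q qs.
  by rewrite (hk k k0k q qs).
have := tw (fun=> circle1 R) k (y - P); rewrite twist1 fourier_psumB PE => h.
apply: le_trans (rnorm_dist _ P _) _; rewrite (rnormB P).
have : rnorm (y - P) * (2 + e) <= r by rewrite -ler_pdivlMr.
by lra.
Qed.

Lemma lacunary_complex_umap : complex_umap Y.
Proof.
split; first exact: spectral_separable.
move=> e e0; have [K tw] := twist_le e0.
exists (fun k => fourier_psum (stage K k) : {linear Y -> Y}); split.
- by move=> y /=; rewrite /fourier_psum big_nil.
- move=> k; exists (fourier_psum_cst X E (stage K k)) => y.
  by rewrite !rnormE -rmorphM lecR; exact: fourier_psum_bound.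
- by move=> k; exact: fourier_psum_finite_rank.
- exact: fourier_psum_stage_cvg e0 tw.
- by move=> m eps y; rewrite !rnormE -rmorphM lecR; exact: tw.
Qed.

End lacunary_umap.

Theorem mainTheorem13 (R : realType) (n : nat -> int)
    (hn : `|(n k.+1)%:~R / (n k)%:~R : R| @[k --> \oo] --> +oo)
    (X : homogeneousBanach R) :
  metric_unconditional_basic_seq X (range n) /\
  complex_umap (spectral X (range n)).
Proof.
split; first exact: lacunary_metric_unconditional.
exact: lacunary_complex_umap.
Qed.
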